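(* Let $\alpha>0$ and let $\mu$ be a positive Borel measure on $(0,\infty)$ such that $\mu((0,1))=0$ and $\sup_{n\in\mathbb{N}}\int_{1}^{\infty}t^{-(n+1)}\,d\mu(t)<\infty$. Then for $p\in(0,\infty)$, the Hausdorff operator $\mathcal{H}_{\mu}$ belongs to the Schatten class $\mathcal{S}_{p}(F^2_{\alpha})$ if and only if $$\sum_{n=0}^{\infty}\left(\int_{1}^{\infty}\frac{1}{t^{n+1}}\,d\mu(t)\right)^{p}<\infty.$$
   Context: $\mathbb{N}=\{0,1,2,\dots\}$. The Fock space $F^2_\alpha$ is the Hilbert space of entire functions $f$ with $\|f\|^2=\frac{\alpha}{\pi}\int_{\mathbb{C}}|f(z)|^2e^{-\alpha|z|^2}\,dA(z)<\infty$, where $dA$ is Lebesgue area measure. For a positive Borel measure $\mu$ on $(0,\infty)$, the Hausdorff operator is $\mathcal{H}_{\mu}(f)(z)=\int_{0}^{\infty}\frac{1}{t}f\left(\frac{z}{t}\right)d\mu(t)$, $z\in\mathbb{C}$. For $0<p<\infty$, $\mathcal{S}_p(F^2_\alpha)$ is the class of compact operators on $F^2_\alpha$ whose sequence of singular values lies in $\ell^p$. *)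

(* Defs.v *)
From HB Require Import structures.
From mathcomp Require Import all_boot all_order all_algebra.
From mathcomp Require Import all_classical all_reals all_analysis.
From mathcomp Require Import complex.
Set Implicit Arguments. Unset Strict Implicit. Unset Printing Implicit Defensive.
Import Order.TTheory GRing.Theory Num.Theory.
Local Open Scope classical_set_scope.
Local Open Scope ring_scope.
Local Open Scope complex_scope.

Section Fock.
Variable R : realType.
Local Notation C := R[i].

Definition cmod (z : C) : R := complex.Re `|z|.

Definition entire (f : C -> C) : Prop :=
  forall z : C, exists l : C, forall e : R, 0 < e -> exists d : R, 0 < d /\
    forall h : C, 0 < cmod h < d -> cmod ((f (z + h) - f z) / h - l) < e.

Definition area := (@lebesgue_measure R \x @lebesgue_measure R)%E.

Definition fock_norm2 (alpha : R) (f : C -> C) : \bar R :=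
  ((alpha / pi)%:E *
   \int[area]_(xy in [set: R * R])
      ((cmod (f (xy.1 +i* xy.2)) ^+ 2 *
        expR (- alpha * (xy.1 ^+ 2 + xy.2 ^+ 2)))%:E))%E.

Definition Fock (alpha : R) : set (C -> C) :=
  [set f | entire f /\ (fock_norm2 alpha f < +oo)%E].

Definition fock_norm (alpha : R) (f : C -> C) : R :=
  Num.sqrt (fine (fock_norm2 alpha f)).

(* operators are maps on functions C -> C; only their action on F^2 matters *)
Definition op := (C -> C) -> (C -> C).

Definition op_maps (alpha : R) (T : op) : Prop :=
  forall f, Fock alpha f -> Fock alpha (T f).

Definition op_linear (alpha : R) (T : op) : Prop :=
  forall (a : C) f g, Fock alpha f -> Fock alpha g ->
    T (fun z => a * f z + g z) = (fun z => a * T f z + T g z).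

Definition op_norm (alpha : R) (T : op) : \bar R :=
  ereal_sup [set (fock_norm alpha (T f))%:E | f in
              [set f | Fock alpha f /\ fock_norm alpha f <= 1]].

Definition bounded_op (alpha : R) (T : op) : Prop :=
  op_maps alpha T /\ op_linear alpha T /\ (op_norm alpha T < +oo)%E.

Definition compact_op (alpha : R) (T : op) : Prop :=
  bounded_op alpha T /\
  forall (u : nat -> C -> C) (M : R),
    (forall k, Fock alpha (u k) /\ fock_norm alpha (u k) <= M) ->
    exists (phi : nat -> nat) (g : C -> C),
      (forall k, (phi k < phi k.+1)%N) /\ Fock alpha g /\
      (fun k => fock_norm alpha (fun z => T (u (phi k)) z - g z)) @ \oo --> 0.

Definition rank_le (alpha : R) (n : nat) (K : op) : Prop :=
  op_maps alpha K /\ op_linear alpha K /\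
  exists g : 'I_n -> C -> C, (forall i, Fock alpha (g i)) /\
    forall f, Fock alpha f -> exists c : 'I_n -> C,
      K f = (fun z => \sum_(i < n) c i * g i z).

(* n-th singular value (approximation number) of T on F^2 *)
Definition sing_val (alpha : R) (T : op) (n : nat) : \bar R :=
  ereal_inf [set op_norm alpha (fun f z => T f z - K f z) | K in rank_le alpha n].

Definition schatten (alpha p : R) (T : op) : Prop :=
  compact_op alpha T /\
  (\sum_(0 <= n <oo) ((fine (sing_val alpha T n)) `^ p)%:E < +oo)%E.

Definition cintegral (mu : {measure set R -> \bar R}) (D : set R) (g : R -> C) : C :=
  (Rintegral mu D (fun t => complex.Re (g t))) +i*
  (Rintegral mu D (fun t => complex.Im (g t))).

Definition hausdorff (mu : {measure set R -> \bar R}) : op :=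
  fun f z => cintegral mu `]0, +oo[ (fun t => (t^-1)%:C * f (z / t%:C)).

End Fock.

(* Main.v *)
Require Import Defs.
From HB Require Import structures.
From mathcomp Require Import all_boot all_order all_algebra.
From mathcomp Require Import all_classical all_reals all_analysis.
From mathcomp Require Import measurable_realfun complex ring lra.
Import Order.TTheory GRing.Theory Num.Theory.
Import numFieldNormedType.Exports ComplexField.Normc.
Local Open Scope classical_set_scope.
Local Open Scope ring_scope.
Set Implicit Arguments. Unset Strict Implicit. Unset Printing Implicit Defensive.

(* Every entire f is the sum of a power series (a_n): Goursat's bisection shows that
   circle means of z q(z), q the difference quotient of f at z0, do not depend on the
   radius, hence vanish, and this is Cauchy's formula.  The area measure is invariant
   under rotations (products of shears), so averaging |f(omega^k z)|^2 over the N-th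
   roots of unity and letting N tend to infinity, with Fatou's lemma on both sides,
   gives Parseval's identity ||f||^2 = sum |a_n|^2 w_n without polar coordinates; of
   the weights w_n = ||z^n||^2 only positivity, finiteness and fast growth are used.
   In these coordinates H_mu is diagonal with the nonincreasing entries
   lam_n = int_1^oo t^-(n+1) dmu.  Truncation gives s_n <= lam_n; conversely, a rank n
   operator kills some nonzero polynomial of degree at most n, on which H_mu expands
   norms by at least lam_n.  So s_n = lam_n, and H_mu is compact once lam_n -> 0. *)

(** * Complex differentiability *)

(** Circles are handled through z = exp w with w = s + i t: the circle of radius e^s becomes a
    vertical segment of length 2 pi, and Cauchy's theorem is only called for axis-parallel
    rectangles in the w-plane, whose horizontal sides cancel by periodicity. The factor z in z q(z)
    comes from dz = z dw; it also makes the means tend to 0 as s tends to -oo, which determines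
    their constant value. On a circle with |z| > |z0|, expanding z q(z) in powers of z0 / z gives
    the Taylor series at the point z0 itself, with an explicit geometric remainder. Roots of unity
    are used because the discrete Parseval identity is exact and pointwise for every N: the N
    components of f have norms adding up to ||f||^2. One use of Fatou sends the components to a_r
    z^r and gives Bessel's inequality; the other sends the Taylor polynomials to f and gives the
    converse. Compactness is also read off coefficients: a bounded sequence has a coordinatewise
    convergent subsequence, and small entries lam_n control the tails uniformly along it. *)

Section ComplexModulus.
Local Open Scope complex_scope.
Variable R : realType.
Local Notation C := R[i].
Local Notation Re := (@complex.Re R).
Local Notation Im := (@complex.Im R).
Implicit Types (z w : C) (r : R).

Lemma cReD z w : Re (z + w) = Re z + Re w. Proof. by case: z; case: w. Qed.
Lemma cImD z w : Im (z + w) = Im z + Im w. Proof. by case: z; case: w. Qed.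
Lemma cReN z : Re (- z) = - Re z. Proof. by case: z. Qed.
Lemma cImN z : Im (- z) = - Im z. Proof. by case: z. Qed.
Lemma cReM z w : Re (z * w) = Re z * Re w - Im z * Im w.
Proof. by case: z; case: w. Qed.
Lemma cImM z w : Im (z * w) = Re z * Im w + Im z * Re w.
Proof. by case: z; case: w. Qed.
Lemma Re_sum (I : Type) (s : seq I) (P : pred I) (F : I -> C) :
  Re (\sum_(i <- s | P i) F i) = \sum_(i <- s | P i) Re (F i).
Proof. by elim/big_ind2: _ => // x1 x2 y1 y2 <- <-; rewrite cReD. Qed.
Lemma Im_sum (I : Type) (s : seq I) (P : pred I) (F : I -> C) :
  Im (\sum_(i <- s | P i) F i) = \sum_(i <- s | P i) Im (F i).
Proof. by elim/big_ind2: _ => // x1 x2 y1 y2 <- <-; rewrite cImD. Qed.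

Lemma ReImE z : z = Re z +i* Im z. Proof. by case: z. Qed.
Lemma ReIm_inj z w : Re z = Re w -> Im z = Im w -> z = w.
Proof. by case: z => a b; case: w => c d /= -> ->. Qed.

Lemma cmodE z : cmod z = Num.sqrt (Re z ^+ 2 + Im z ^+ 2).
Proof. by rewrite /cmod normc_def. Qed.
Lemma cmod_normc z : cmod z = normc z.
Proof. by case: z => a b; rewrite cmodE. Qed.
Lemma cmod_sqr z : cmod z ^+ 2 = Re z ^+ 2 + Im z ^+ 2.
Proof. by rewrite cmodE sqr_sqrtr// addr_ge0// sqr_ge0. Qed.
Lemma cmod_ge0 z : 0 <= cmod z. Proof. by rewrite cmodE sqrtr_ge0. Qed.
Lemma cmodM z w : cmod (z * w) = cmod z * cmod w.
Proof. by rewrite !cmod_normc normcM. Qed.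
Lemma ler_cmodD z w : cmod (z + w) <= cmod z + cmod w.
Proof. by rewrite !cmod_normc le_normcD. Qed.
Lemma cmodN z : cmod (- z) = cmod z.
Proof. by rewrite !cmod_normc normcN. Qed.
Lemma cmod0 : cmod (0 : C) = 0.
Proof. by rewrite cmod_normc normc0. Qed.
Lemma cmod1 : cmod (1 : C) = 1.
Proof. by rewrite cmod_normc normc1. Qed.
Lemma cmodV z : cmod z^-1 = (cmod z)^-1.
Proof. by rewrite !cmod_normc normcV. Qed.
Lemma cmodX z n : cmod (z ^+ n) = cmod z ^+ n.
Proof. by elim: n => [|n IH]; rewrite ?expr0 ?cmod1// !exprS cmodM IH. Qed.
Lemma cmodB z w : cmod (z - w) = cmod (w - z).
Proof. by rewrite -cmodN opprB. Qed.
Lemma cmod_eq0 z : (cmod z == 0) = (z == 0).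
Proof.
apply/eqP/eqP => [|->]; last exact: cmod0.
by rewrite cmod_normc; exact: eq0_normc.
Qed.
Lemma cmod_gt0 z : (0 < cmod z) = (z != 0).
Proof. by rewrite lt_def cmod_eq0 cmod_ge0 andbT. Qed.
Lemma cmodC r : cmod r%:C = `|r|.
Proof. by rewrite cmodE /= expr0n /= addr0 sqrtr_sqr. Qed.
Lemma ler_Re_cmod z : `|Re z| <= cmod z.
Proof.
by rewrite cmodE -sqrtr_sqr ler_wsqrtr// lerDl sqr_ge0.
Qed.
Lemma ler_Im_cmod z : `|Im z| <= cmod z.
Proof.
by rewrite cmodE -sqrtr_sqr ler_wsqrtr// lerDr sqr_ge0.
Qed.
Lemma ler_cmod_ReIm z : cmod z <= `|Re z| + `|Im z|.
Proof.
rewrite -(@ler_pXn2r _ 2)// ?nnegrE ?cmod_ge0 ?addr_ge0// cmod_sqr sqrrD.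
by rewrite !real_normK ?num_real// addrAC lerDl mulrn_wge0// mulr_ge0.
Qed.
Lemma ler_cmod_sum (I : Type) (s : seq I) (P : pred I) (F : I -> C) :
  cmod (\sum_(i <- s | P i) F i) <= \sum_(i <- s | P i) cmod (F i).
Proof.
elim/big_ind2: _ => [|x1 x2 y1 y2 h1 h2|//]; first by rewrite cmod0.
exact: le_trans (ler_cmodD _ _) (lerD h1 h2).
Qed.
Lemma ler_cmod_dist z w : `|cmod z - cmod w| <= cmod (z - w).
Proof.
rewrite ler_norml; apply/andP; split.
  rewrite lerNl opprB lerBlDr -{1}(subrK z w) cmodB addrC.
  by rewrite (le_trans (ler_cmodD _ _))// addrC cmodB.
by rewrite lerBlDr -{1}(subrK w z) ler_cmodD.
Qed.

Definition cexp z : C := (expR (Re z))%:C * (cos (Im z) +i* sin (Im z)).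

Lemma cexpD z w : cexp (z + w) = cexp z * cexp w.
Proof.
rewrite /cexp cReD cImD expRD cosD sinD; apply: ReIm_inj => /=; ring.
Qed.
Lemma cmod_cexp z : cmod (cexp z) = expR (Re z).
Proof.
rewrite cmodM cmodC ger0_norm ?expR_ge0// cmodE /= cos2Dsin2 sqrtr1 mulr1 //.
Qed.
Lemma cexp_neq0 z : cexp z != 0.
Proof. by rewrite -cmod_gt0 cmod_cexp expR_gt0. Qed.
Lemma cexp0 : cexp 0 = 1.
Proof. by rewrite /cexp /= expR0 cos0 sin0; apply: ReIm_inj => /=; ring. Qed.
Lemma cexpMn z n : cexp (z *+ n) = cexp z ^+ n.
Proof. by elim: n => [|n IH]; rewrite ?mulr0n ?cexp0// mulrS cexpD IH exprS. Qed.
Lemma cexp2pi z : cexp (z + 0 +i* (pi *+ 2)) = cexp z.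
Proof.
rewrite cexpD {2}/cexp /= expR0 cos2pi -[pi *+ 2]add0r sinD2pi sin0.
by apply: ReIm_inj; rewrite !(cReM, cImM) /=; ring.
Qed.

End ComplexModulus.

(** * Continuity and Caratheodory derivatives of complex functions *)

Section ComplexContinuity.
Local Open Scope complex_scope.
Variable R : realType.
Local Notation C := R[i].
Local Notation Re := (@complex.Re R).
Local Notation Im := (@complex.Im R).

(* R[i] has no topology in the library: continuity is that of both components. *)
Definition ccont (T : topologicalType) (F : T -> C) (t : T) : Prop :=
  (Re (F x) @[x --> t] --> Re (F t)) /\ (Im (F x) @[x --> t] --> Im (F t)).

Definition mkc (p : R * R) : C := p.1 +i* p.2.
Definition pairc (z : C) : R * R := (Re z, Im z).
Lemma paircK : cancel pairc mkc. Proof. by case. Qed.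
Lemma mkcK : cancel mkc pairc. Proof. by case. Qed.

Section Top.
Local Open Scope complex_scope.
Variable T : topologicalType.
Implicit Types (F G : T -> C) (t : T).

Lemma ccont_cst (c : C) t : ccont (fun _ => c) t.
Proof. by split; exact: cvg_cst. Qed.
Lemma ccontD F G t : ccont F t -> ccont G t -> ccont (fun x => F x + G x) t.
Proof.
move=> [a b] [c d]; split.
  by under eq_fun do rewrite cReD; rewrite cReD; exact: cvgD.
by under eq_fun do rewrite cImD; rewrite cImD; exact: cvgD.
Qed.
Lemma ccontN F t : ccont F t -> ccont (fun x => - F x) t.
Proof.
move=> [a b]; split.
  by under eq_fun do rewrite cReN; rewrite cReN; exact: cvgN.
by under eq_fun do rewrite cImN; rewrite cImN; exact: cvgN.
Qed.
Lemma ccontB F G t : ccont F t -> ccont G t -> ccont (fun x => F x - G x) t.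
Proof. by move=> a b; apply: ccontD => //; exact: ccontN. Qed.
Lemma ccontM F G t : ccont F t -> ccont G t -> ccont (fun x => F x * G x) t.
Proof.
move=> [a b] [c d]; split.
  under eq_fun do rewrite cReM; rewrite cReM.
  by apply: cvgB; apply: cvgM.
under eq_fun do rewrite cImM; rewrite cImM.
by apply: cvgD; apply: cvgM.
Qed.
Lemma ccontX F t n : ccont F t -> ccont (fun x => F x ^+ n) t.
Proof.
move=> cF; elim: n => [|n IH].
  by under eq_fun do rewrite expr0; exact: ccont_cst.
by under eq_fun do rewrite exprS; exact: ccontM.
Qed.
Lemma ccont_sum (F_ : nat -> T -> C) (s : seq nat) t : (forall n : nat, ccont (F_ n) t) ->
  ccont (fun x => \sum_(i <- s) F_ i x) t.
Proof.
move=> h; elim: s => [|i s IH].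
  by under eq_fun do rewrite big_nil; exact: ccont_cst.
by under eq_fun do rewrite big_cons; exact: ccontD.
Qed.
Lemma cReV (z : C) : Re z^-1 = Re z / (Re z ^+ 2 + Im z ^+ 2).
Proof. by case: z. Qed.
Lemma cImV (z : C) : Im z^-1 = - (Im z / (Re z ^+ 2 + Im z ^+ 2)).
Proof. by case: z. Qed.
Lemma ReIm_neq0 (z : C) : z != 0 -> Re z ^+ 2 + Im z ^+ 2 != 0.
Proof. by rewrite -cmod_sqr expf_eq0 /= cmod_eq0. Qed.
Lemma ccontV F t : F t != 0 -> ccont F t -> ccont (fun x => (F x)^-1) t.
Proof.
move=> Ft0 [a b].
have c : (Re (F x) ^+ 2 + Im (F x) ^+ 2)^-1 @[x --> t] -->
    (Re (F t) ^+ 2 + Im (F t) ^+ 2)^-1.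
  apply: cvgV; first exact: ReIm_neq0.
  by rewrite !expr2; under eq_fun do rewrite !expr2; apply: cvgD; apply: cvgM.
split.
  by under eq_fun do rewrite cReV; rewrite cReV; exact: cvgM.
by under eq_fun do rewrite cImV; rewrite cImV; apply: cvgN; exact: cvgM.
Qed.
Lemma ccont_eq F G t : F =1 G -> ccont F t -> ccont G t.
Proof. by move=> /funext ->. Qed.

(** The topology lives on [R * R], so [G] is composed as the pair of its real and imaginary
    parts. *)
Lemma ccont_comp (phi : C -> C) G t : ccont (phi \o mkc) (pairc (G t)) ->
  ccont G t -> ccont (fun x => phi (G x)) t.
Proof.
move=> [a b] [c d].
have e : (Re (G x), Im (G x)) @[x --> t] --> pairc (G t).
  exact: (cvg_pair c d).
split.
  have := cvg_comp _ (fun p : R * R => Re ((phi \o mkc) p)) e a; rewrite /= paircK; apply: cvg_trans.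
  by apply: near_eq_cvg; near=> x; rewrite /= paircK.
have := cvg_comp _ (fun p : R * R => Im ((phi \o mkc) p)) e b; rewrite /= paircK; apply: cvg_trans.
by apply: near_eq_cvg; near=> x; rewrite /= paircK.
Unshelve. all: by end_near. Qed.
Lemma cmod_cont F t : ccont F t -> cmod (F x) @[x --> t] --> cmod (F t).
Proof.
move=> [a b]; rewrite cmodE.
under eq_fun do rewrite cmodE.
apply: (@cvg_comp _ _ _ _ (@Num.sqrt R)); last exact: sqrt_continuous.
by rewrite !expr2; under eq_fun do rewrite !expr2; apply: cvgD; apply: cvgM.
Qed.
Lemma cont_cmod F t : (cmod (F x - F t) @[x --> t] --> cmod (F t - F t)) -> ccont F t.
Proof.
rewrite subrr cmod0 => /cvgrPdist_lt h; split.
  apply/cvgrPdist_lt => e e0; have := h _ e0; apply: filterS => x.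
  rewrite sub0r normrN ger0_norm ?cmod_ge0//; apply: le_lt_trans.
  by rewrite cmodB -cReN -cReD ler_Re_cmod.
apply/cvgrPdist_lt => e e0; have := h _ e0; apply: filterS => x.
rewrite sub0r normrN ger0_norm ?cmod_ge0//; apply: le_lt_trans.
by rewrite cmodB -cImN -cImD ler_Im_cmod.
Qed.

End Top.

Lemma ccont_mkc (p : R * R) : ccont mkc p.
Proof. by split; [exact: cvg_fst|exact: cvg_snd]. Qed.
Lemma ccont_hline (y x : R) : ccont (fun t => t +i* y) x.
Proof. by split; [exact: cvg_id|exact: cvg_cst]. Qed.
Lemma ccont_vline (x y : R) : ccont (fun t => x +i* t) y.
Proof. by split; [exact: cvg_cst|exact: cvg_id]. Qed.

Lemma ccontP (phi : C -> C) z : ccont (phi \o mkc) (pairc z) <->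
  forall e : R, 0 < e -> exists2 d : R, 0 < d &
    forall w, cmod (w - z) < d -> cmod (phi w - phi z) < e.
Proof.
split.
  move=> h e e0.
  have : ccont (fun p => phi (mkc p) - phi z) (pairc z).
    by apply: ccontB => //; exact: ccont_cst.
  move=> /cmod_cont; rewrite paircK subrr cmod0.
  move=> /cvgrPdist_lt /(_ _ e0) /nbhs_ballP[d /= d0 hd].
  exists d => // w wz; have := hd (pairc w).
  rewrite /= paircK sub0r normrN ger0_norm ?cmod_ge0//; apply.
  split; rewrite /ball/= distrC.
    by rewrite -cReN -cReD (le_lt_trans (ler_Re_cmod _)).
  by rewrite -cImN -cImD (le_lt_trans (ler_Im_cmod _)).
have E : (phi \o mkc) (pairc z) = phi z by rewrite /= paircK.
move=> h; apply: cont_cmod; rewrite E subrr cmod0.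
apply/cvgrPdist_lt => e e0; have [d d0 hd] := h _ e0.
suff : nbhs (pairc z) [set p | `|0 - cmod (phi (mkc p) - phi z)| < e] by [].
(* A ball of [R * R] is a square; half the radius fits it into the disc, as |z| <= |Re z| + |Im
   z|. *)
apply/nbhs_ballP; exists (d / 2) => /=; first by rewrite divr_gt0.
move=> [x y] [/= ]; rewrite /ball/= => hx hy.
rewrite sub0r normrN ger0_norm ?cmod_ge0//; apply: hd.
rewrite (le_lt_trans (ler_cmod_ReIm _))// cReD cReN cImD cImN /=.
by rewrite (splitr d) ltrD// distrC.
Qed.

(* Caratheodory's form of complex differentiability at z. *)
Definition cdiff (g : C -> C) (z : C) : Prop := exists phi : C -> C,
  ccont (phi \o mkc) (pairc z) /\ forall w, g w - g z = phi w * (w - z).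

Lemma cdiff_cont g z : cdiff g z -> ccont (g \o mkc) (pairc z).
Proof.
move=> [phi [cphi h]].
have e : (fun p => phi (mkc p) * (mkc p - z) + g z) =1 g \o mkc.
  by move=> p /=; rewrite -h subrK.
apply: (ccont_eq e); apply: ccontD; last exact: ccont_cst.
apply: ccontM => //; apply: ccontB; [exact: ccont_mkc|exact: ccont_cst].
Qed.
Lemma cdiff_cst c z : cdiff (fun=> c) z.
Proof. by exists (fun=> 0); split=> [|w]; [exact: ccont_cst|rewrite subrr mul0r]. Qed.
Lemma cdiff_id z : cdiff id z.
Proof. by exists (fun=> 1); split=> [|w]; [exact: ccont_cst|rewrite mul1r]. Qed.
Lemma cdiffD f g z : cdiff f z -> cdiff g z -> cdiff (fun w => f w + g w) z.
Proof.
move=> [p [cp hp]] [q [cq hq]]; exists (fun w => p w + q w); split.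
  exact: ccontD.
by move=> w; rewrite mulrDl -hp -hq; ring.
Qed.
Lemma cdiffM f g z : cdiff f z -> cdiff g z -> cdiff (fun w => f w * g w) z.
Proof.
move=> df [q [cq hq]]; have cf := cdiff_cont df; case: df => p [cp hp].
exists (fun w => p w * g z + f w * q w); split.
  apply: ccontD; apply: ccontM => //; exact: ccont_cst.
by move=> w; rewrite mulrDl mulrAC -hp -mulrA -hq; ring.
Qed.
Lemma ccont_near (f g : C -> C) z (d : R) : 0 < d ->
  (forall w, cmod (w - z) < d -> f w = g w) ->
  ccont (f \o mkc) (pairc z) -> ccont (g \o mkc) (pairc z).
Proof.
move=> d0 fg /ccontP h; apply/ccontP => e e0; have [d' d'0 hd] := h e e0.
exists (Num.min d d') => [|w]; first by rewrite lt_min d0.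
rewrite lt_min => /andP[wd wd']; rewrite -!fg ?hd// subrr cmod0//.
Qed.
Lemma cdiff_near f g z (d : R) : 0 < d ->
  (forall w, cmod (w - z) < d -> f w = g w) -> cdiff f z -> cdiff g z.
Proof.
move=> d0 fg [p [cp hp]].
(* The factorisation must hold for all [w], so far from [z] the slope is the difference quotient;
   its continuity is only asked at [z]. *)
exists (fun w => if cmod (w - z) < d then p w else (g w - g z) / (w - z)); split.
  by apply: (ccont_near d0 _ cp) => w ->.
move=> w; case: ifPn => [wd|wd].
  by rewrite -hp -!fg// subrr cmod0.
rewrite divfK// subr_eq0; apply: contraNneq wd => ->.
by rewrite subrr cmod0.
Qed.
Lemma cdiffV f z : f z != 0 -> cdiff f z -> cdiff (fun w => (f w)^-1) z.
Proof.
move=> fz df; have cf := cdiff_cont df; case: df => p [cp hp].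
have fz0 : 0 < cmod (f z) by rewrite cmod_gt0.
have [d d0 hd] := (ccontP f z).1 cf _ fz0.
have fn0 w : cmod (w - z) < d -> f w != 0.
  move=> /hd; apply: contraTneq => ->.
  by rewrite sub0r cmodN ltxx.
(* [f] may vanish away from [z], so the usual formula is kept to a disc where it does not. *)
exists (fun w => if cmod (w - z) < d then - p w / (f w * f z)
                 else ((f w)^-1 - (f z)^-1) / (w - z)); split.
  apply: (@ccont_near (fun w => - p w / (f w * f z)) _ _ d) => // [w -> //|].
  apply: ccontM; first exact: ccontN.
  apply: ccontV; first by rewrite mulf_neq0//= paircK.
  by apply: ccontM => //; exact: ccont_cst.
move=> w; case: ifPn => [wd|wd].
  rewrite mulrAC mulNr -hp; field; by rewrite fz fn0.
rewrite divfK// subr_eq0; apply: contraNneq wd => ->.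
by rewrite subrr cmod0.
Qed.
Lemma cdiff_comp f g z : cdiff f (g z) -> cdiff g z -> cdiff (fun w => f (g w)) z.
Proof.
move=> [p [cp hp]] dg; have cg := cdiff_cont dg; case: dg => q [cq hq].
exists (fun w => p (g w) * q w); split.
  apply: ccontM => //; apply: (@ccont_comp _ p (g \o mkc)) => //=.
  by rewrite paircK.
by move=> w; rewrite hp hq mulrA.
Qed.


Lemma cdiff_quot f z l : (forall e : R, 0 < e -> exists d : R, 0 < d /\
    forall h : C, 0 < cmod h < d -> cmod ((f (z + h) - f z) / h - l) < e) ->
  cdiff f z.
Proof.
move=> H; exists (fun w => if w == z then l else (f w - f z) / (w - z)); split.
  apply/ccontP => e e0; have [d [d0 hd]] := H e e0; exists d => // w wz.
  rewrite eqxx; case: eqVneq => [_|wnz]; first by rewrite subrr cmod0.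
  have -> : f w = f (z + (w - z)) by rewrite addrC subrK.
  by apply: hd; rewrite wz cmod_gt0 subr_eq0 wnz.
move=> w; case: eqVneq => [->|wnz]; first by rewrite !subrr mulr0.
by rewrite divfK// subr_eq0.
Qed.

Lemma entire_cdiff f z : entire f -> cdiff f z.
Proof. by move=> /(_ z)[l hl]; exact: cdiff_quot hl. Qed.

Lemma is_derive0_bound (f : R -> R) (l : R) : is_derive (0 : R) 1 f l ->
  forall e : R, 0 < e -> exists2 d : R, 0 < d &
    forall x, `|x| < d -> `|f x - f 0 - l * x| <= e * `|x|.
Proof.
move=> df e e0; have [dd dl] := df.
have : h^-1 *: ((f \o shift (0 : R)) (h *: 1) - f 0) @[h --> 0^'] --> l.
  by rewrite -dl; exact: dd.
move=> /cvgrPdist_lt /(_ _ e0).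
rewrite /dnbhs /within /= => /nbhs_ballP[d /= d0 hd].
exists d => // x xd; have [->|x0] := eqVneq x 0.
  by rewrite mulr0 subrr subr0 normr0 mulr0.
have := hd x; rewrite /ball /= sub0r normrN => /(_ xd x0).
rewrite addr0 /GRing.scale /= mulr1 => /ltW h.
have -> : f x - f 0 - l * x = - (l - x^-1 * (f x - f 0)) * x by field.
by rewrite normrM normrN ler_wpM2r.
Qed.

(** The addition theorem reduces this to exp h - 1 - h = o(|h|), which the real derivatives of exp,
    cos and sin at 0 provide. *)
Lemma cdiff_cexp z : cdiff (@cexp R) z.
Proof.
apply: (@cdiff_quot _ _ (cexp z)) => e e0.
have Ez : 0 < expR (Re z) by exact: expR_gt0.
have [k [k0 k1 ke]] : exists k, [/\ 0 < k, k <= 1 & k <= e / (8 * expR (Re z))].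
  exists (Num.min 1 (e / (8 * expR (Re z)))).
  by rewrite lt_min ltr01 divr_gt0 ?mulr_gt0// !ge_min !lexx orbT.
have [d1 d10 h1] := is_derive0_bound (is_derive_expR (0 : R)) k0.
have [d2 d20 h2] := is_derive0_bound (is_derive_cos (0 : R)) k0.
have [d3 d30 h3] := is_derive0_bound (is_derive_sin (0 : R)) k0.
exists (Num.min k (Num.min d1 (Num.min d2 d3))); split.
  by rewrite !lt_min k0 d10 d20.
move=> h /andP[h0]; rewrite !lt_min => /and4P[hk hd1 hd2 hd3].
have hn0 : h != 0 by rewrite -cmod_gt0.
have -> : (cexp (z + h) - cexp z) / h - cexp z =
    cexp z * ((cexp h - 1 - h) / h).
  by rewrite cexpD; field.
rewrite cmodM cmod_cexp cmodM cmodV.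
set x := Re h; set y := Im h.
have xh : `|x| <= cmod h := ler_Re_cmod h.
have yh : `|y| <= cmod h := ler_Im_cmod h.
have {}h1 : `|expR x - 1 - x| <= k * cmod h.
  have := h1 x (le_lt_trans xh hd1); rewrite expR0 mul1r => /le_trans; apply.
  by rewrite ler_wpM2l// ltW.
have {}h2 : `|cos y - 1| <= k * cmod h.
  have := h2 y (le_lt_trans yh hd2).
  rewrite cos0 sin0 oppr0 mul0r subr0 => /le_trans; apply.
  by rewrite ler_wpM2l// ltW.
have {}h3 : `|sin y - y| <= k * cmod h.
  have := h3 y (le_lt_trans yh hd3).
  rewrite cos0 sin0 mul1r subr0 => /le_trans; apply.
  by rewrite ler_wpM2l// ltW.
(* Each summand has one small factor: the error of exp, the errors of cos and sin, and the product x
   y. *)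
have eqh : cexp h - 1 - h = (expR x - 1 - x)%:C * (cos y +i* sin y) +
    (1 + x)%:C * ((cos y - 1) +i* (sin y - y)) + x%:C * (0 +i* y).
  by rewrite /cexp -/x -/y {1}(ReImE h) -/x -/y; apply: ReIm_inj => /=; ring.
have x1 : `|1 + x| <= 2.
  rewrite (le_trans (ler_normD _ _))// normr1 -[2]/(1 + 1) lerD2l.
  by rewrite (le_trans xh)// (le_trans (ltW hk)).
have b2 : cmod ((cos y - 1) +i* (sin y - y)) <= 2 * (k * cmod h).
  by rewrite (le_trans (ler_cmod_ReIm _))//= mulr_natl mulr2n lerD.
(* The summands contribute 1, 2 * 2 and 1; the 8 in the choice of [k] leaves room for a strict
   inequality. *)
have H : cmod (cexp h - 1 - h) <= 6 * (k * cmod h).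
  rewrite eqh (le_trans (ler_cmodD _ _))//.
  have -> : 6 * (k * cmod h) = (k * cmod h + 2 * (2 * (k * cmod h))) + k * cmod h.
    by ring.
  apply: lerD.
    rewrite (le_trans (ler_cmodD _ _))// !cmodM !cmodC.
    apply: lerD; last by rewrite ler_pM ?cmod_ge0.
    by rewrite (cmodE (_ +i* _)) /= cos2Dsin2 sqrtr1 mulr1.
  rewrite cmodM cmodC (cmodE (_ +i* _)) /= expr0n /= add0r sqrtr_sqr.
  by rewrite ler_pM// (le_trans xh)// ltW.
have : expR (Re z) * (cmod (cexp h - 1 - h) / cmod h) <= expR (Re z) * (6 * k).
  by rewrite ler_pM2l// ler_pdivrMr// -mulrA.
move=> /le_lt_trans; apply.
move: ke; rewrite ler_pdivlMr ?mulr_gt0// => hk8.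
have : expR (Re z) * (6 * k) = (6 / 8) * (k * (8 * expR (Re z))) by field.
move=> ->; apply: (@le_lt_trans _ _ (6 / 8 * e)); last by lra.
by rewrite ler_pM2l//; lra.
Qed.

End ComplexContinuity.

(** * Goursat's lemma and Taylor series *)

Section IntervalIntegral.
Local Open Scope complex_scope.
Variable R : realType.
Local Notation C := R[i].
Local Notation Re := (@complex.Re R).
Local Notation Im := (@complex.Im R).
Local Notation leb := (@lebesgue_measure R).
Implicit Types (h : R -> C) (a b : R).

Definition cint h a b : C :=
  (\int[leb]_(t in `[a, b]) Re (h t)) +i* (\int[leb]_(t in `[a, b]) Im (h t)).

Lemma cont_itv_integrable (f : R -> R) a b :
  continuous f -> leb.-integrable `[a, b] (EFin \o f).
Proof.
move=> cf; apply: continuous_compact_integrable; first exact: segment_compact.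
exact: continuous_subspaceT.
Qed.

Lemma ccont_integrable h a b : (forall t, ccont h t) ->
  leb.-integrable `[a, b] (EFin \o (Re \o h)) /\
  leb.-integrable `[a, b] (EFin \o (Im \o h)).
Proof. by move=> ch; split; apply: cont_itv_integrable => t; case: (ch t). Qed.

Lemma eq_cint h1 h2 a b : (forall t, a <= t <= b -> h1 t = h2 t) ->
  cint h1 a b = cint h2 a b.
Proof.
move=> e; rewrite /cint; congr Complex; apply: eq_Rintegral => t;
by rewrite inE /= in_itv/= => /e ->.
Qed.

Lemma cintD h1 h2 a b : (forall t, ccont h1 t) -> (forall t, ccont h2 t) ->
  cint (fun t => h1 t + h2 t) a b = cint h1 a b + cint h2 a b.
Proof.
move=> /(@ccont_integrable _ a b)[r1 i1] /(@ccont_integrable _ a b)[r2 i2].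
apply: ReIm_inj; rewrite ?cReD ?cImD /= -RintegralD//;
by apply: eq_Rintegral => t _; rewrite ?cReD ?cImD.
Qed.

Lemma cintZ (c : C) h a b : (forall t, ccont h t) ->
  cint (fun t => c * h t) a b = c * cint h a b.
Proof.
move=> /(@ccont_integrable _ a b)[r1 i1].
have iZ (x : R) f : leb.-integrable `[a, b] (EFin \o f) ->
    leb.-integrable `[a, b] (EFin \o (fun t => x * f t)).
  by move=> fi; exact: (@integrableZl _ _ _ leb `[a, b] (measurable_itv _) x _ fi).
apply: ReIm_inj.
  rewrite cReM /= -!RintegralZl// -RintegralB//; first last.
  - exact: iZ.
  - exact: iZ.
  by apply: eq_Rintegral => t _; rewrite cReM.
rewrite cImM /= -!RintegralZl// -RintegralD//; first last.
- exact: iZ.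
- exact: iZ.
by apply: eq_Rintegral => t _; rewrite cImM.
Qed.

Lemma cintB h1 h2 a b : (forall t, ccont h1 t) -> (forall t, ccont h2 t) ->
  cint (fun t => h1 t - h2 t) a b = cint h1 a b - cint h2 a b.
Proof.
move=> c1 c2; rewrite -(mulN1r (cint h2 a b)) -cintZ// -cintD//.
  by apply: eq_cint => t _; rewrite mulN1r.
by move=> t; apply: ccontM => //; exact: ccont_cst.
Qed.

Lemma cint_sum (h_ : nat -> R -> C) (s : seq nat) a b :
  (forall n t, ccont (h_ n) t) ->
  cint (fun t => \sum_(n <- s) h_ n t) a b = \sum_(n <- s) cint (h_ n) a b.
Proof.
move=> ch; elim: s => [|n s IH].
  have c0 : cint (fun=> 0) a b = 0.
    rewrite -[RHS](mul0r (cint (fun=> 0) a b)) -cintZ => [|t]; last exact: ccont_cst.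
    by apply: eq_cint => t _; rewrite mul0r.
  by rewrite big_nil -[RHS]c0; apply: eq_cint => t _; rewrite big_nil.
rewrite big_cons -IH -cintD//; first by apply: eq_cint => t _; rewrite big_cons.
by move=> t; exact: ccont_sum.
Qed.

Lemma Rintegral_itv_split (f : R -> R) a b c : continuous f -> a <= b -> b <= c ->
  \int[leb]_(t in `[a, c]) f t =
  \int[leb]_(t in `[a, b]) f t + \int[leb]_(t in `[b, c]) f t.
Proof.
move=> cf ab bc; have fi := cont_itv_integrable a c cf.
have := Rintegral_itvB fi (x := b).
rewrite !bnd_simp => /(_ ab bc) /eqP; rewrite subr_eq addrC => /eqP ->.
congr (_ + _); apply: Rintegral_itv_obnd_cbnd.
by apply: integrableS (cont_itv_integrable b c cf) => //; exact: subset_itv_oc_cc.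
Qed.

Lemma cint_split h a b c : (forall t, ccont h t) -> a <= b -> b <= c ->
  cint h a c = cint h a b + cint h b c.
Proof.
move=> ch ab bc; apply: ReIm_inj; rewrite ?cReD ?cImD /=;
by apply: Rintegral_itv_split => // t; case: (ch t).
Qed.

Lemma Rintegral_near_cst (f : R -> R) r M a b : continuous f -> a <= b ->
  (forall t, a <= t <= b -> `|f t - r| <= M) ->
  `|\int[leb]_(t in `[a, b]) f t - r * (b - a)| <= M * (b - a).
Proof.
move=> cf ab hM; have fi := cont_itv_integrable a b cf.
have cst x : \int[leb]_(t in `[a, b]) x = x * (b - a).
  rewrite Rintegral_cst//= lebesgue_measure_itv /= lte_fin.
  by move: ab; rewrite le_eqVlt => /predU1P[->|->]; rewrite ?ltxx ?subrr ?mulr0.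
have ci x : leb.-integrable `[a, b] (EFin \o (fun=> x)).
  by apply: cont_itv_integrable; exact: cst_continuous.
have cfr : continuous (fun t => f t - r).
  by move=> t; apply: cvgB; [exact: cf|exact: cvg_cst].
rewrite -cst -RintegralB// -(cst M).
rewrite (le_trans (le_normr_Rintegral _ _))//.
  exact: cont_itv_integrable.
apply: le_Rintegral => //.
  by apply: cont_itv_integrable => t; apply: cvg_norm; exact: cfr.
Qed.

(** The factor 2 is the price of estimating real and imaginary parts separately. *)
Lemma cint_near_cst h (c : C) M a b : (forall t, ccont h t) -> a <= b ->
  (forall t, a <= t <= b -> cmod (h t - c) <= M) ->
  cmod (cint h a b - c * (b - a)%:C) <= 2 * M * (b - a).
Proof.
move=> ch ab hM; rewrite (le_trans (ler_cmod_ReIm _))//.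
rewrite mulrAC mulr_natl mulr2n mulrDl !(mulrC (b - a)); apply: lerD.
  rewrite cReD cReN cReM /= mulr0 subr0; apply: Rintegral_near_cst => //.
    by move=> t; case: (ch t).
  by move=> t /hM; rewrite -cReN -cReD; apply: le_trans; exact: ler_Re_cmod.
rewrite cImD cImN cImM /= mulr0 add0r; apply: Rintegral_near_cst => //.
  by move=> t; case: (ch t).
by move=> t /hM; rewrite -cImN -cImD; apply: le_trans; exact: ler_Im_cmod.
Qed.

Lemma cint_bound h M a b : (forall t, ccont h t) -> a <= b ->
  (forall t, a <= t <= b -> cmod (h t) <= M) ->
  cmod (cint h a b) <= 2 * M * (b - a).
Proof.
move=> ch ab hM; have := @cint_near_cst h 0 M a b ch ab.
by rewrite mul0r subr0; apply => t /hM; rewrite subr0.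
Qed.

End IntervalIntegral.

(** * Goursat's lemma for rectangles *)

Section Goursat.
Local Open Scope complex_scope.
Variable R : realType.
Local Notation C := R[i].
Local Notation Re := (@complex.Re R).
Local Notation Im := (@complex.Im R).
Variable g : C -> C.
Hypothesis cg : forall z, ccont (g \o @mkc R) (pairc z).
Implicit Types (x y A B : R).

(** The counterclockwise contour integral around [x, x + A] x [y, y + B]: dz is dt on horizontal
    sides and i dt on vertical ones. *)
Definition rect_int x y A B : C :=
  cint (fun t => g (t +i* y)) x (x + A)
  - cint (fun t => g (t +i* (y + B))) x (x + A)
  + (0 +i* 1) * (cint (fun t => g ((x + A) +i* t)) y (y + B)
                 - cint (fun t => g (x +i* t)) y (y + B)).

Lemma ccont_on_hline y t : ccont (fun t => g (t +i* y)) t.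
Proof. apply: (ccont_comp (cg _)); exact: ccont_hline. Qed.
Lemma ccont_on_vline x t : ccont (fun t => g (x +i* t)) t.
Proof. apply: (ccont_comp (cg _)); exact: ccont_vline. Qed.

Let chl := ccont_on_hline.
Let cvl := ccont_on_vline.

Lemma rect_int_split x y A B : 0 <= A -> 0 <= B ->
  rect_int x y A B =
  rect_int x y (A / 2) (B / 2) + rect_int (x + A / 2) y (A / 2) (B / 2) +
  (rect_int x (y + B / 2) (A / 2) (B / 2) +
   rect_int (x + A / 2) (y + B / 2) (A / 2) (B / 2)).
Proof.
move=> A0 B0; rewrite /rect_int -!addrA -!splitr.
have [a1 a2] : x <= x + A / 2 /\ x + A / 2 <= x + A by split; lra.
have [b1 b2] : y <= y + B / 2 /\ y + B / 2 <= y + B by split; lra.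
rewrite (cint_split (chl y) a1 a2) (cint_split (chl (y + B)) a1 a2).
rewrite (cint_split (cvl (x + A)) b1 b2) (cint_split (cvl x) b1 b2).
ring.
Qed.

Lemma quarter_le (M a b c d : R) : 4 * M <= a + b + (c + d) ->
  [\/ M <= a, M <= b, M <= c | M <= d].
Proof.
move=> h; have [ha|ha] := leP M a; first by constructor 1.
have [hb|hb] := leP M b; first by constructor 2.
have [hc|hc] := leP M c; first by constructor 3.
by constructor 4; lra.
Qed.

Lemma rect_int_quarter (p : R * R) A B : 0 <= A -> 0 <= B ->
  exists q : R * R, [/\ p.1 <= q.1, q.1 + A / 2 <= p.1 + A,
    p.2 <= q.2, q.2 + B / 2 <= p.2 + B &
    cmod (rect_int p.1 p.2 A B) / 4 <= cmod (rect_int q.1 q.2 (A / 2) (B / 2))].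
Proof.
have half (a D : R) : 0 <= D ->
    [/\ a <= a + D / 2, a + D / 2 <= a + D & a + D / 2 + D / 2 <= a + D].
  by move=> D0; split; lra.
case: p => x y A0 B0; have [a1 a2 a3] := half x A A0; have [b1 b2 b3] := half y B B0.
rewrite [(x, y).1]/= [(x, y).2]/= rect_int_split//.
set I := rect_int x y _ _ + _ + _; have hI : 4 * (cmod I / 4) <=
    cmod (rect_int x y (A / 2) (B / 2)) + cmod (rect_int (x + A / 2) y (A / 2) (B / 2)) +
    (cmod (rect_int x (y + B / 2) (A / 2) (B / 2)) +
     cmod (rect_int (x + A / 2) (y + B / 2) (A / 2) (B / 2))).
  rewrite mulrCA divff// mulr1; apply: (le_trans (ler_cmodD _ _)).
  by apply: lerD; exact: ler_cmodD.
have [h|h|h|h] := quarter_le hI.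
- by exists (x, y).
- by exists (x + A / 2, y).
- by exists (x, y + B / 2).
- by exists (x + A / 2, y + B / 2).
Qed.

(** Opposite sides are paired: up to the error of linearisation, the difference of [g] at facing
    points is [l] times a constant displacement. *)
Lemma rect_int_local (p : C) : cdiff g p -> forall e : R, 0 < e ->
  exists2 d : R, 0 < d & forall x y A B, 0 <= A -> 0 <= B -> A + B < d ->
    x <= Re p <= x + A -> y <= Im p <= y + B ->
    cmod (rect_int x y A B) <= 4 * e * (A + B) ^+ 2.
Proof.
move=> [phi [cphi hphi]] e e0.
have [d d0 hd] := (ccontP phi p).1 cphi e e0.
exists d => // x y A B A0 B0 ABd /andP[xp px] /andP[yp py].
set l := phi p.
have lin w : `|Re w - Re p| <= A -> `|Im w - Im p| <= B ->
    cmod (g w - g p - l * (w - p)) <= e * (A + B).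
  move=> wA wB; have wp : cmod (w - p) <= A + B.
    by rewrite (le_trans (ler_cmod_ReIm _))// cReD cReN cImD cImN lerD.
  rewrite hphi -mulrBl cmodM ler_pM ?cmod_ge0// ltW// hd//.
  exact: le_lt_trans wp ABd.
have diff w w' : `|Re w - Re p| <= A -> `|Im w - Im p| <= B ->
    `|Re w' - Re p| <= A -> `|Im w' - Im p| <= B ->
    cmod ((g w - g w') - l * (w - w')) <= 2 * e * (A + B).
  move=> h1 h2 h3 h4.
  have -> : g w - g w' - l * (w - w') =
     (g w - g p - l * (w - p)) - (g w' - g p - l * (w' - p)) by ring.
  rewrite (le_trans (ler_cmodD _ _))// cmodN -mulrA mulr_natl mulr2n.
  by apply: lerD; exact: lin.
have i1 := @cint_near_cst _ (fun t => g (t +i* y) - g (t +i* (y + B)))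
  (l * (0 +i* (- B))) (2 * e * (A + B)) x (x + A).
have i2 := @cint_near_cst _ (fun t => g ((x + A) +i* t) - g (x +i* t))
  (l * A%:C) (2 * e * (A + B)) y (y + B).
rewrite !cintB// in i1 i2.
have {}i1 := i1 (fun t => ccontB (chl y t) (chl (y + B) t)).
have {}i2 := i2 (fun t => ccontB (cvl (x + A) t) (cvl x t)).
rewrite /rect_int; set H := (X in X + _); set V := (X in _ * X).
(* The subtracted main terms cancel: l (-i B) A + i (l A) B = 0. *)
have -> : H + (0 +i* 1) * V = (H - l * (0 +i* - B) * (x + A - x)%:C) +
   (0 +i* 1) * (V - l * A%:C * (y + B - y)%:C).
  rewrite !(addrC x) !(addrC y) !addrK.
  have -> : (0 +i* (- B)) = - ((0 +i* 1) * B%:C) :> C.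
    by apply: ReIm_inj; rewrite !(cReN,cImN,cReM,cImM) /=; ring.
  ring.
have -> : 4 * e * (A + B) ^+ 2 =
    2 * (2 * e * (A + B)) * (x + A - x) + 2 * (2 * e * (A + B)) * (y + B - y).
  by ring.
rewrite (le_trans (ler_cmodD _ _))// lerD//.
  apply: i1; first by lra.
  move=> t /andP[t1 t2].
  have -> : 0 +i* (- B) = (t +i* y) - (t +i* (y + B)) :> C.
    by apply: ReIm_inj; rewrite !(cReD,cReN,cImD,cImN) /=; ring.
  by apply: diff => /=; rewrite ler_norml; lra.
rewrite cmodM cmodE /= expr0n /= add0r expr1n sqrtr1 mul1r.
apply: i2; first by lra.
move=> t /andP[t1 t2].
have -> : A%:C = ((x + A) +i* t) - (x +i* t) :> C.
  by apply: ReIm_inj; rewrite !(cReD,cReN,cImD,cImN) /=; ring.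
by apply: diff => /=; rewrite ler_norml; lra.
Qed.

Lemma nested_itv_common (u : nat -> R) (A : R) : 0 <= A ->
  (forall n, u n <= u n.+1) ->
  (forall n, u n.+1 + A / 2 ^+ n.+1 <= u n + A / 2 ^+ n) ->
  exists l, forall n, u n <= l <= u n + A / 2 ^+ n.
Proof.
move=> A0 nd ni.
have An n : 0 <= A / 2 ^+ n by rewrite divr_ge0// exprn_ge0.
have uD n k : u n <= u (n + k)%N /\
    u (n + k)%N + A / 2 ^+ (n + k) <= u n + A / 2 ^+ n.
  elim: k => [|k [h1 h2]]; first by rewrite addn0.
  by rewrite addnS (le_trans h1)// (le_trans (ni _)).
have ub m n : u m <= u n + A / 2 ^+ n.
  have [mn|nm] := leqP m n.
    have [h _] := uD m (n - m)%N; rewrite subnKC// in h.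
    by rewrite (le_trans h)// lerDl.
  have [_] := uD n (m - n)%N; rewrite (subnKC (ltnW nm)) => h.
  by rewrite (le_trans _ h)// lerDl.
have hs : has_sup (range u).
  split; first by exists (u 0%N), 0%N.
  by exists (u 0%N + A / 2 ^+ 0) => _ [m _ <-].
exists (sup (range u)) => n; apply/andP; split.
  by apply: ub_le_sup; [case: hs|exists n].
by apply: ge_sup; [case: hs|move=> _ [m _ <-]].
Qed.

Lemma goursat x y A B : 0 <= A -> 0 <= B ->
  (forall z, x <= Re z <= x + A -> y <= Im z <= y + B -> cdiff g z) ->
  rect_int x y A B = 0.
Proof.
move=> A0 B0 dg.
have pos D n : 0 <= D -> 0 <= D / 2 ^+ n :> R.
  by move=> D0; rewrite divr_ge0// exprn_ge0.
(* [F (n, q)] is the corner of a quarter that keeps at least a fourth of the integral; [s] iterates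
   it. *)
have [F hF] := choice (fun q : nat * (R * R) =>
  @rect_int_quarter q.2 (A / 2 ^+ q.1) (B / 2 ^+ q.1) (pos A q.1 A0) (pos B q.1 B0)).
pose s := fix s n := if n is m.+1 then F (m, s m) else (x, y).
have half (D : R) n : D / 2 ^+ n / 2 = D / 2 ^+ n.+1.
  by rewrite exprS invfM; ring.
have [p1 h1] : exists l, forall n, (s n).1 <= l <= (s n).1 + A / 2 ^+ n.
  apply: nested_itv_common => // n; first by have [] := hF (n, s n).
  by have [_] := hF (n, s n); rewrite /= half.
have [p2 h2] : exists l, forall n, (s n).2 <= l <= (s n).2 + B / 2 ^+ n.
  apply: nested_itv_common => // n; first by have [] := hF (n, s n).
  by have [_ _ _] := hF (n, s n); rewrite /= half.
have hI n : cmod (rect_int x y A B) / 4 ^+ n <=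
    cmod (rect_int (s n).1 (s n).2 (A / 2 ^+ n) (B / 2 ^+ n)).
  elim: n => [|n IH]; first by rewrite !expr0 !divr1.
  have [_ _ _ _] := hF (n, s n); rewrite /= !half; apply: le_trans.
  by rewrite exprS invfM mulrA mulrAC ler_pM2r.
apply/eqP; rewrite -cmod_eq0 eq_le cmod_ge0 andbT leNgt; apply/negP => M0.
set M := cmod (rect_int x y A B) in M0 hI.
have dp : cdiff g (p1 +i* p2).
  apply: dg => /=; first by have := h1 0%N; rewrite expr0 divr1.
  by have := h2 0%N; rewrite expr0 divr1.
(* Chosen so that [4 * e * (A + B) ^+ 2] is at most M / 2; the 1 covers a rectangle reduced to a
   point. *)
pose e := M / (8 * ((A + B) ^+ 2 + 1)).
have S0 : 0 < (A + B) ^+ 2 + 1 by rewrite ltr_wpDl// sqr_ge0.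
have e0 : 0 < e by rewrite divr_gt0// mulr_gt0.
have [d d0 hd] := rect_int_local dp e0.
have [n hn] : exists n, (A + B) / 2 ^+ n < d.
  exists (Num.bound ((A + B) / d)); rewrite ltr_pdivrMr ?exprn_gt0//.
  rewrite -ltr_pdivrMl// mulrC (lt_trans (archi_boundP _))//.
    by rewrite divr_ge0 ?addr_ge0// ltW.
  by rewrite -natrX ltr_nat ltn_expl.
have := le_trans (hI n) (hd _ _ _ _ (pos _ n A0) (pos _ n B0) _ (h1 n) (h2 n)).
rewrite -mulrDl => /(_ hn).
rewrite expr_div_n.
have -> : (2 ^+ n) ^+ 2 = 4 ^+ n :> R.
  by rewrite -exprM mulnC exprM; congr (_ ^+ n); ring.
have n4 : 0 < 4 ^+ n :> R by rewrite exprn_gt0.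
rewrite mulrA ler_pM2r ?invr_gt0// => h.
have E : 4 * e * (A + B) ^+ 2 = M / 2 * ((A + B) ^+ 2 / ((A + B) ^+ 2 + 1)).
  by rewrite /e; field; rewrite gt_eqF.
have : (A + B) ^+ 2 / ((A + B) ^+ 2 + 1) <= 1 by rewrite ler_pdivrMr// mul1r lerDl.
move=> /(ler_wpM2l (ltW M0)); move: h M0; rewrite E; lra.
Qed.

End Goursat.

(** * Circle means and Cauchy's formula *)

Section CircleAverage.
Local Open Scope complex_scope.
Variable R : realType.
Local Notation C := R[i].
Local Notation Re := (@complex.Re R).
Local Notation Im := (@complex.Im R).
Local Notation twopi := (pi *+ 2 : R).

(** For g w = G (exp w) this is 2 pi times the mean of G over the circle of radius e^s. *)
Definition circ_int (g : C -> C) (s : R) : C := cint (fun t => g (s +i* t)) 0 twopi.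

Let twopi_ge0 : 0 <= twopi. Proof. by rewrite mulrn_wge0// pi_ge0. Qed.

Lemma half_share_le (T e : R) : 0 <= T -> 0 < e -> 2 * (e / (2 * (T + 1))) * T <= e.
Proof.
move=> T0 e0; have T1 : 0 < T + 1 by rewrite ltr_wpDl.
have -> : 2 * (e / (2 * (T + 1))) * T = e * (T / (T + 1)) by field; rewrite gt_eqF.
by rewrite ger_pMr// ler_pdivrMr// mul1r lerDl.
Qed.

Section Periodic.
Local Open Scope complex_scope.
Variable g : C -> C.
Hypothesis cg : forall z, ccont (g \o @mkc R) (pairc z).
Hypothesis pg : forall z, g (z + 0 +i* twopi) = g z.

(** In the rectangle of height 2 pi the horizontal sides cancel by periodicity, so the vertical ones
    agree. *)
Lemma circ_int_le s s' : s <= s' ->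
  (forall z, s <= Re z <= s' -> cdiff g z) -> circ_int g s = circ_int g s'.
Proof.
move=> ss' dg; have := @goursat _ g cg s 0 (s' - s) twopi.
rewrite subr_ge0 ss' twopi_ge0 => /(_ isT isT).
have E : s + (s' - s) = s' by rewrite addrC subrK.
rewrite /rect_int !E !add0r.
have -> : cint (fun t => g (t +i* twopi)) s s' = cint (fun t => g (t +i* 0)) s s'.
  apply: eq_cint => t _; rewrite -(pg (t +i* 0)); congr g.
  by apply: ReIm_inj; rewrite ?(cReD,cImD) /= ?addr0 ?add0r.
rewrite subrr add0r => H; have {}H : (0 +i* 1 : C) * (circ_int g s' - circ_int g s) = 0.
  by apply: H => z h _; exact: dg.
move/eqP : H; rewrite mulf_eq0 subr_eq0 => /orP[|/eqP //].
by rewrite eq_complex /= oner_eq0 andbF.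
Qed.

Lemma circ_int_cont s0 (e : R) : 0 < e -> exists2 d : R, 0 < d &
  forall s, `|s - s0| < d -> cmod (circ_int g s - circ_int g s0) <= e.
Proof.
move=> e0; pose k := e / (2 * (twopi + 1)).
have tp1 : 0 < twopi + 1 by rewrite ltr_wpDl.
have k0 : 0 < k by rewrite divr_gt0// mulr_gt0.
(* Compactness of [0, 2 pi] makes the closeness of [g] on neighbouring lines uniform in [t]. *)
have /compact_near_coveringP/(_ R (nbhs s0)
  (fun s t => cmod (g (s +i* t) - g (s0 +i* t)) < k)) := @segment_compact R 0 twopi.
move=> /(_ _) [].
  move=> t _.
  have h1 : ccont (fun p : R * R => g (p.2 +i* p.1) - g (s0 +i* p.1)) (t, s0).
    apply: ccontB; apply: (ccont_comp (cg _)); split => /=.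
    - exact: cvg_snd.
    - exact: cvg_fst.
    - exact: cvg_cst.
    - exact: cvg_fst.
  have /cmod_cont := h1; rewrite /= subrr cmod0 => /cvgrPdist_lt /(_ _ k0).
  apply: filterS => -[t' s] /=.
  by rewrite sub0r normrN ger0_norm ?cmod_ge0.
move=> d /= d0 hd; exists d => // s sd.
have {}hd t : 0 <= t <= twopi -> cmod (g (s +i* t) - g (s0 +i* t)) <= k.
  by move=> ht; rewrite ltW// hd//= ?in_itv//= distrC.
have cl x t : ccont (fun t => g (x +i* t)) t by exact: ccont_on_vline.
rewrite /circ_int -cintB//.
rewrite (le_trans (cint_bound _ _ hd))//; first by move=> t; exact: ccontB.
rewrite subr0 /k.
exact: half_share_le.
Qed.

(* An exceptional line Re z = s0 is harmless since circle means are continuous in s;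
   it is needed at s0 = ln |z0|, where exp z can meet the point z0. *)
Lemma circ_int_cst s0 : (forall z, Re z != s0 -> cdiff g z) ->
  forall s s', circ_int g s = circ_int g s'.
Proof.
move=> dg; suff H s : circ_int g s = circ_int g s0 by move=> s s'; rewrite !H.
have [->//|ss0] := eqVneq s s0.
apply/eqP; rewrite -subr_eq0 -cmod_eq0 eq_le cmod_ge0 andbT.
apply/ler_addgt0Pl => e e0; rewrite addr0.
have [d d0 hd] := circ_int_cont s0 e0.
case: (ltgtP s s0) ss0 => // ss0 _.
  (* Goursat moves [s] to within [d] of [s0] without reaching the exceptional line; continuity does
     the rest. *)
  pose r := Num.max s (s0 - d / 2).
  have rs0 : r < s0 by rewrite gt_max ss0 ltrBlDr ltrDl divr_gt0.
  have sr : s <= r by rewrite le_max lexx.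
  rewrite (circ_int_le sr); last first.
    by move=> z /andP[_ zr]; apply: dg; rewrite lt_eqF// (le_lt_trans zr).
  apply: hd; rewrite ltr0_norm ?subr_lt0// opprB ltrBlDr -ltrBlDl.
  by rewrite lt_max; apply/orP; right; lra.
pose r := Num.min s (s0 + d / 2).
have rs0 : s0 < r by rewrite lt_min ss0 ltrDl divr_gt0.
have sr : r <= s by rewrite ge_min lexx.
rewrite -(circ_int_le sr); last first.
  by move=> z /andP[zr _]; apply: dg; rewrite gt_eqF// (lt_le_trans rs0).
apply: hd; rewrite gtr0_norm ?subr_gt0// ltrBlDr.
by rewrite gt_min; apply/orP; right; lra.
Qed.

(** The mean does not depend on the radius, so one circle on which [g] is small suffices. *)
Lemma circ_int_eq0 s0 : (forall z, Re z != s0 -> cdiff g z) ->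
  (forall e : R, 0 < e -> exists s, forall t, cmod (g (s +i* t)) <= e) ->
  forall s, circ_int g s = 0.
Proof.
move=> dg small s; apply/eqP; rewrite -cmod_eq0 eq_le cmod_ge0 andbT.
apply/ler_addgt0Pl => e e0; rewrite addr0.
have tp1 : 0 < twopi + 1 by rewrite ltr_wpDl.
have k0 : 0 < e / (2 * (twopi + 1)) by rewrite divr_gt0// mulr_gt0.
have [s' hs'] := small _ k0.
rewrite (circ_int_cst dg s s').
rewrite (le_trans (cint_bound _ _ (fun t _ => hs' t)))//.
  by move=> t; exact: ccont_on_vline.
rewrite subr0.
exact: half_share_le.
Qed.

End Periodic.

Definition hasps (f : C -> C) (a : nat -> C) : Prop :=
  forall z, cmod (\sum_(0 <= k < n) a k * z ^+ k - f z) @[n --> \oo] --> (0 : R).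

Lemma cexp_line_neq (z0 w : C) : Re w != ln (cmod z0) -> cexp w != z0.
Proof. by apply: contraNneq => <-; rewrite cmod_cexp expRK. Qed.

Lemma cont_cexp z : ccont (@cexp R \o @mkc R) (pairc z).
Proof. exact: cdiff_cont (cdiff_cexp z). Qed.

Lemma ccont_cexp_comp (f : C -> C) : (forall z, ccont (f \o @mkc R) (pairc z)) ->
  forall z, ccont ((fun w => f (cexp w)) \o @mkc R) (pairc z).
Proof. by move=> cf z; apply: (ccont_comp (cf _)); exact: cont_cexp. Qed.

Lemma cdiff_cexpV n z : cdiff (fun w : C => (cexp w)^-1 ^+ n) z.
Proof.
elim: n => [|n IH]; first exact: cdiff_cst.
have -> : (fun w : C => (cexp w)^-1 ^+ n.+1) =
  (fun w => (cexp w)^-1 * (cexp w)^-1 ^+ n) by apply/funext => w; rewrite exprS.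
apply: cdiffM IH; apply: cdiffV; [exact: cexp_neq0|exact: cdiff_cexp].
Qed.

Lemma circ_int_cexpV n s : circ_int (fun w => (cexp w)^-1 ^+ n) s =
  (if n is 0%N then twopi else 0)%:C.
Proof.
case: n => [|n].
  have -> : circ_int (fun w => (cexp w)^-1 ^+ 0) s = cint (fun=> 1) 0 twopi by [].
  have := @cint_near_cst R (fun=> 1) 1 0 0 twopi (fun t => ccont_cst _ _) twopi_ge0.
  rewrite mulr0 mul0r subr0 => /(_ _)/wrap[].
    by move=> t _; rewrite subrr cmod0.
  rewrite mul1r => h; apply/eqP.
  by rewrite -subr_eq0 -cmod_eq0 eq_le h cmod_ge0.
apply: (@circ_int_eq0 _ _ _ 0).
- by move=> z; exact: cdiff_cont (cdiff_cexpV _ _).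
- by move=> z; rewrite cexp2pi.
- by move=> z _; exact: cdiff_cexpV.
(* Large circles make negative powers small; the 0 ensures that every factor after the first is at
   most 1. *)
move=> e e0; exists (Num.max 0 (- ln e)) => t.
rewrite cmodX cmodV cmod_cexp /= -expRN exprS.
set m := Num.max _ _.
have m0 : 0 <= m by rewrite le_max lexx.
have h1 : expR (- m) <= 1 by rewrite -expR0 ler_expR oppr_le0.
rewrite (@le_trans _ _ (expR (- m)))//.
  by rewrite ger_pMr ?expR_gt0// exprn_ile1// expR_ge0.
rewrite -[leRHS]lnK ?posrE// ler_expR lerNl le_max lexx orbT//.
Qed.

Lemma cont_circle_bounded (h : C -> C) s :
  (forall z, ccont (h \o @mkc R) (pairc z)) ->
  exists B, forall t, 0 <= t <= twopi -> cmod (h (s +i* t)) <= B.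
Proof.
move=> ch; have [] := @EVT_max R (fun t => cmod (h (s +i* t))) 0 twopi twopi_ge0.
  by apply: continuous_subspaceT => t; apply: cmod_cont; exact: ccont_on_vline.
by move=> c _ hc; exists (cmod (h (s +i* c))) => t ht; apply: hc; rewrite in_itv.
Qed.

(** Cauchy's coefficient formula on the unit circle; [coefE] below transfers it to all radii. *)
Definition taylor_coef (f : C -> C) (n : nat) : C :=
  circ_int (fun w => f (cexp w) * (cexp w)^-1 ^+ n) 0 / twopi%:C.

Lemma entire_hasps (f : C -> C) : entire f -> hasps f (taylor_coef f).
Proof.
move=> ef z0; have df z := entire_cdiff z ef; have cf z := cdiff_cont (df z).
have coefE n s :
    circ_int (fun w => f (cexp w) * (cexp w)^-1 ^+ n) s = twopi%:C * taylor_coef f n.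
  rewrite /taylor_coef mulrC divfK; last first.
    by rewrite eq_complex /= negb_and mulrn_eq0 /= gt_eqF ?pi_gt0.
  have d w : cdiff (fun w => f (cexp w) * (cexp w)^-1 ^+ n) w.
    apply: cdiffM; last exact: cdiff_cexpV.
    by apply: (cdiff_comp (df _)); exact: cdiff_cexp.
  apply: (@circ_int_cst _ _ _ 0) => [z|z|z _]; [exact: cdiff_cont| |exact: d].
  by rewrite cexp2pi.
(* [phi] is the difference quotient of [f] at [z0], continuous also at [z0]. *)
have [phi [cphi hphi]] := df z0.
have phiE w : w != z0 -> phi w = (f w - f z0) / (w - z0).
  by move=> wz; rewrite hphi mulfK// subr_eq0.
have dphi w : w != z0 -> cdiff phi w.
  move=> wz; have wz0 : 0 < cmod (w - z0) by rewrite cmod_gt0 subr_eq0.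
  apply: (@cdiff_near _ (fun w => (f w - f z0) / (w - z0)) _ _ _ wz0).
    move=> v vw; rewrite phiE//; apply: contraTneq vw => ->.
    by rewrite cmodB ltxx.
  apply: cdiffM.
    by apply: cdiffD; [exact: df|exact: cdiff_cst].
  apply: cdiffV; first by rewrite subr_eq0.
  by apply: cdiffD; [exact: cdiff_id|exact: cdiff_cst].
have {}cphi w : ccont (phi \o @mkc R) (pairc w).
  by have [->//|wz] := eqVneq w z0; exact: cdiff_cont (dphi _ wz).
pose g w := cexp w * phi (cexp w).
have cg w : ccont (g \o @mkc R) (pairc w).
  by apply: ccontM; [exact: cont_cexp|exact: ccont_cexp_comp].
have g0 s : circ_int g s = 0.
  apply: (@circ_int_eq0 _ cg _ (ln (cmod z0))).
  - by move=> w; rewrite /g cexp2pi.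
  - move=> w /cexp_line_neq wz; apply: cdiffM; first exact: cdiff_cexp.
    by apply: cdiff_comp; [exact: dphi|exact: cdiff_cexp].
  (* Near 0 the quotient is bounded by [M], so on a small circle of radius [r] the factor [cexp w]
     forces |g| <= r M <= e. *)
  move=> e e0; have [d d0 hd] := (ccontP phi 0).1 (cphi 0) 1 ltr01.
  pose M := cmod (phi 0) + 1.
  have M0 : 0 < M by rewrite ltr_wpDl ?cmod_ge0.
  pose r := Num.min (d / 2) (e / M).
  have r0 : 0 < r by rewrite lt_min !divr_gt0.
  exists (ln r) => t; rewrite /g cmodM cmod_cexp /= lnK ?posrE//.
  have : cmod (phi (cexp (ln r +i* t))) <= M.
    have := hd (cexp (ln r +i* t)); rewrite subr0 cmod_cexp /= lnK ?posrE//.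
    have rd : r < d by rewrite gt_min; apply/orP; left; lra.
    move=> /(_ rd) /ltW h.
    by rewrite -(subrK (phi 0) (phi (cexp _))) (le_trans (ler_cmodD _ _))// addrC lerD2l.
  move=> h; apply: (@le_trans _ _ (e / M * M)); last by rewrite divfK// gt_eqF.
  by apply: ler_pM => //; [exact: ltW|exact: cmod_ge0|rewrite ge_min lexx orbT].
(* Any circle around 0 enclosing [z0] would do; here e^s >= 1 + s > |z0|. *)
pose s := cmod z0.
have sz : cmod z0 < expR s.
  by rewrite (lt_le_trans _ (expR_ge1Dx _))// ltrDr.
pose rho := cmod z0 / expR s.
have rho0 : 0 <= rho by rewrite divr_ge0 ?cmod_ge0 ?expR_ge0.
have rho1 : rho < 1 by rewrite ltr_pdivrMr ?expR_gt0// mul1r.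
have [B hB] := cont_circle_bounded s cg.
have cV n w : ccont ((fun w => (cexp w)^-1 ^+ n) \o @mkc R) (pairc w).
  exact: cdiff_cont (cdiff_cexpV n w).
have cc (h : C -> C) t : (forall w, ccont (h \o @mkc R) (pairc w)) ->
  ccont (fun t => h (s +i* t)) t by move=> ch; exact: ccont_on_vline.
have cterm k w : ccont ((fun w => z0 ^+ k * (f (cexp w) * (cexp w)^-1 ^+ k
     - f z0 * (cexp w)^-1 ^+ k)) \o @mkc R) (pairc w).
  apply: ccontM; first exact: ccont_cst.
  apply: ccontB; apply: ccontM => //; try exact: cV.
    exact: ccont_cexp_comp.
  exact: ccont_cst.
have cE N w : ccont ((fun w => (z0 / cexp w) ^+ N * g w) \o @mkc R) (pairc w).
  apply: ccontM => //; apply: ccontX; apply: ccontM; first exact: ccont_cst.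
  have := cV 1%N w; by [].
(* With z = exp w and q the difference quotient at z0, this integrates z q(z) = (f(z) - f(z0))
   sum_(k<N) (z0/z)^k + (z0/z)^N z q(z). *)
have split_g N : circ_int g s =
    \sum_(0 <= k < N) z0 ^+ k * (circ_int (fun w => f (cexp w) * (cexp w)^-1 ^+ k) s
      - f z0 * circ_int (fun w => (cexp w)^-1 ^+ k) s)
    + circ_int (fun w => (z0 / cexp w) ^+ N * g w) s.
  transitivity (circ_int (fun w => \sum_(0 <= k < N) z0 ^+ k *
     (f (cexp w) * (cexp w)^-1 ^+ k - f z0 * (cexp w)^-1 ^+ k)
     + (z0 / cexp w) ^+ N * g w) s).
    apply: eq_cint => t _ /=; set w := s +i* t.
    have En0 := cexp_neq0 w; set E := cexp w in En0 *.
    have -> : \sum_(0 <= k < N) z0 ^+ k * (f E * E^-1 ^+ k - f z0 * E^-1 ^+ k) =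
       (f E - f z0) * \sum_(0 <= k < N) (z0 / E) ^+ k.
      rewrite big_distrr /=; apply: eq_bigr => k _; rewrite expr_div_n exprVn.
      by ring.
    rewrite hphi /g -/E.
    have -> : E - z0 = - (E * (z0 / E - 1)) by field.
    have := subrX1 (z0 / E) N; rewrite -(big_mkord xpredT) => e.
    transitivity (phi E * E - phi E * E * ((z0 / E) ^+ N - 1) + phi E * E * ((z0 / E) ^+ N - 1)).
      by ring.
    by rewrite {1}e; ring.
  rewrite {1}/circ_int cintD; last 2 first.
  - by move=> t; apply: ccont_sum => k; exact: cc (cterm k).
  - by move=> t; exact: cc (cE N).
  congr (_ + _); rewrite (@cint_sum _ (fun k t => z0 ^+ k * (f (cexp (s +i* t)) *
     (cexp (s +i* t))^-1 ^+ k - f z0 * (cexp (s +i* t))^-1 ^+ k))); last first.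
    by move=> k t; exact: cc (cterm k).
  apply: eq_bigr => k _.
  have c1 t : ccont (fun t => (cexp (s +i* t))^-1 ^+ k) t by exact: cc (cV k).
  have c2 t : ccont (fun t => f (cexp (s +i* t)) * (cexp (s +i* t))^-1 ^+ k) t.
    by apply: ccontM => //; apply: (cc (fun w => f (cexp w))); exact: ccont_cexp_comp.
  have c3 t : ccont (fun t => f z0 * (cexp (s +i* t))^-1 ^+ k) t.
    by apply: ccontM => //; exact: ccont_cst.
  by rewrite cintZ ?cintB ?cintZ// => t; exact: ccontB.
(* [N.+1] guarantees the term k = 0, the only one where the mean of z^-k survives; it produces
   [f z0]. *)
have est N : cmod (\sum_(0 <= k < N.+1) taylor_coef f k * z0 ^+ k - f z0) <= 2 * B * rho ^+ N.+1.
  have := split_g N.+1; rewrite g0.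
  have -> : \sum_(0 <= k < N.+1) z0 ^+ k * (circ_int (fun w => f (cexp w) * (cexp w)^-1 ^+ k) s
      - f z0 * circ_int (fun w => (cexp w)^-1 ^+ k) s) =
      twopi%:C * (\sum_(0 <= k < N.+1) taylor_coef f k * z0 ^+ k - f z0).
    under eq_bigr do rewrite coefE circ_int_cexpV.
    rewrite big_nat_recl// [in RHS]big_nat_recl//= !expr0.
    have -> : \sum_(0 <= i < N) z0 ^+ i.+1 *
        (twopi%:C * taylor_coef f i.+1 - f z0 * (0 : R)%:C) =
        twopi%:C * \sum_(0 <= i < N) taylor_coef f i.+1 * z0 ^+ i.+1.
      by rewrite big_distrr /=; apply: eq_bigr => i _; rewrite (_ : (0 : R)%:C = 0)//; ring.
    by ring.
  move=> /esym/eqP; rewrite addr_eq0 => /eqP/(congr1 (@cmod R)).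
  rewrite cmodN cmodM cmodC ger0_norm// => h.
  have : twopi * cmod (\sum_(0 <= k < N.+1) taylor_coef f k * z0 ^+ k - f z0) <=
      2 * (rho ^+ N.+1 * B) * (twopi - 0).
    rewrite h; apply: cint_bound => //; first by move=> t; exact: cc (cE _).
    move=> t ht; rewrite cmodM cmodX cmodM cmodV cmod_cexp /=.
    by rewrite ler_wpM2l ?exprn_ge0// hB.
  rewrite subr0 (mulrC twopi) ler_pM2r; last by rewrite mulrn_wgt0// pi_gt0.
  by move=> /le_trans; apply; rewrite (mulrC (rho ^+ _)) mulrA.
rewrite -cvg_shiftS /=.
have c0 : 2 * B * rho ^+ n.+1 @[n --> \oo] --> (0 : R).
  rewrite -(mulr0 (2 * B)); apply: cvgM; first exact: cvg_cst.
  have := @cvg_expr R rho; rewrite ger0_norm// => /(_ rho1).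
  by rewrite -(cvg_shiftS (fun n => rho ^+ n)).
apply: (squeeze_cvgr _ (cvg_cst 0) c0).
by near=> n; rewrite cmod_ge0 est.
Unshelve. all: by end_near. Qed.

End CircleAverage.

(** * Everywhere convergent power series *)

Section PowerSeries.
Local Open Scope complex_scope.
Variable R : realType.
Local Notation C := R[i].
Local Notation Re := (@complex.Re R).
Local Notation Im := (@complex.Im R).
Implicit Types (u v : nat -> C) (l : C).

Definition ccvg u l : Prop := cmod (u n - l) @[n --> \oo] --> (0 : R).

Lemma ccvg_ReIm u l : ccvg u l <->
  (Re (u n) @[n --> \oo] --> Re l /\ Im (u n) @[n --> \oo] --> Im l).
Proof.
split=> [ul|[/cvgrPdist_lt h1 /cvgrPdist_lt h2]].
  split; apply/cvgrPdist_lt => e e0; move/cvgrPdist_lt/(_ _ e0): ul;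
  apply: filterS => n; rewrite sub0r normrN ger0_norm ?cmod_ge0// cmodB;
  apply: le_lt_trans.
  - by rewrite -cReN -cReD ler_Re_cmod.
  - by rewrite -cImN -cImD ler_Im_cmod.
apply/cvgrPdist_lt => e e0; near=> n.
rewrite sub0r normrN ger0_norm ?cmod_ge0// cmodB.
rewrite (le_lt_trans (ler_cmod_ReIm _))// (splitr e) cReD cReN cImD cImN ltrD//.
  by near: n; apply: h1; rewrite divr_gt0.
by near: n; apply: h2; rewrite divr_gt0.
Unshelve. all: by end_near. Qed.

Lemma ccvg_cst l : ccvg (fun=> l) l.
Proof. by apply/ccvg_ReIm; split; exact: cvg_cst. Qed.
Lemma ccvgD u v l l' : ccvg u l -> ccvg v l' -> ccvg (fun n => u n + v n) (l + l').
Proof.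
move=> /ccvg_ReIm[a b] /ccvg_ReIm[c d]; apply/ccvg_ReIm; split.
  by under eq_fun do rewrite cReD; rewrite cReD; exact: cvgD.
by under eq_fun do rewrite cImD; rewrite cImD; exact: cvgD.
Qed.
Lemma ccvgM u v l l' : ccvg u l -> ccvg v l' -> ccvg (fun n => u n * v n) (l * l').
Proof.
move=> /ccvg_ReIm[a b] /ccvg_ReIm[c d]; apply/ccvg_ReIm; split.
  by under eq_fun do rewrite cReM; rewrite cReM; apply: cvgB; apply: cvgM.
by under eq_fun do rewrite cImM; rewrite cImM; apply: cvgD; apply: cvgM.
Qed.
Lemma ccvgZ (c : C) u l : ccvg u l -> ccvg (fun n => c * u n) (c * l).
Proof. by apply: ccvgM; exact: ccvg_cst. Qed.
Lemma ccvgB u v l l' : ccvg u l -> ccvg v l' -> ccvg (fun n => u n - v n) (l - l').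
Proof.
move=> a /(ccvgZ (-1)) b; rewrite -mulN1r.
by under [X in ccvg X _]eq_fun do rewrite -mulN1r; exact: ccvgD.
Qed.
Lemma ccvg_unique u l l' : ccvg u l -> ccvg u l' -> l = l'.
Proof.
move=> /ccvg_ReIm[a b] /ccvg_ReIm[c d]; apply: ReIm_inj.
  by rewrite -(cvg_lim (@Rhausdorff R) a) -(cvg_lim (@Rhausdorff R) c).
by rewrite -(cvg_lim (@Rhausdorff R) b) -(cvg_lim (@Rhausdorff R) d).
Qed.
Lemma ccvg_cmod u l : ccvg u l -> cmod (u n) @[n --> \oo] --> cmod l.
Proof.
move=> /cvgrPdist_lt h; apply/cvgrPdist_lt => e e0; move: (h _ e0).
apply: filterS => n; rewrite sub0r normrN ger0_norm ?cmod_ge0// cmodB.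
exact/le_lt_trans/ler_cmod_dist.
Qed.
Lemma ccvg_le u l (M : R) N : (forall n, (N <= n)%N -> cmod (u n) <= M) ->
  ccvg u l -> cmod l <= M.
Proof.
move=> uM /ccvg_cmod h; rewrite -(cvg_lim _ h)//; apply: limr_le.
  by apply/cvg_ex; eexists; exact: h.
by near=> n; apply: uM; near: n; exact: nbhs_infty_ge.
Unshelve. all: by end_near. Qed.

Lemma geom_partial_le u (M : R) N n : (forall k, cmod (u k) <= M / 2 ^+ k) ->
  (N <= n)%N ->
  cmod (\sum_(0 <= k < n) u k - \sum_(0 <= k < N) u k) <= 2 * M / 2 ^+ N.
Proof.
move=> uM Nn; have M0 : 0 <= M.
  by have := uM 0%N; rewrite expr0 divr1; apply: le_trans; exact: cmod_ge0.
(* This sharper bound is inductive: it grows by exactly M / 2^n when [n] increases by one. *)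
suff : cmod (\sum_(0 <= k < n) u k - \sum_(0 <= k < N) u k) <=
    2 * M / 2 ^+ N - 2 * M / 2 ^+ n.
  by move=> /le_trans; apply; rewrite lerBlDr lerDl divr_ge0 ?mulr_ge0// exprn_ge0.
rewrite -(subnKC Nn); elim: (n - N)%N => [|j IH].
  by rewrite addn0 !subrr cmod0.
rewrite addnS big_nat_recr//= addrAC (le_trans (ler_cmodD _ _))//.
rewrite (le_trans (lerD IH (uM _)))// exprS invfM.
set t := (2 ^+ (N + j))^-1; rewrite -subr_ge0.
by have -> : 2 * M / 2 ^+ N - 2 * M * (2^-1 * t) - (2 * M / 2 ^+ N - 2 * M * t + M * t) = 0
  by field; rewrite expf_neq0.
Qed.

Lemma geom_ccvg u (M : R) : (forall k, cmod (u k) <= M / 2 ^+ k) ->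
  exists l, ccvg (fun n => \sum_(0 <= k < n) u k) l.
Proof.
move=> uM; have M0 : 0 <= M.
  by have := uM 0%N; rewrite expr0 divr1; apply: le_trans; exact: cmod_ge0.
have H (w : nat -> R) : (forall k, `|w k| <= M / 2 ^+ k) -> cvgn (series w).
  move=> wM; apply: normed_cvg; apply: (@series_le_cvg _ _ (geometric M 2^-1)) => //.
  - by move=> n; exact: normr_ge0.
  - by move=> n; rewrite /= mulr_ge0// exprn_ge0.
  - by move=> n; rewrite /= exprVn; exact: wM.
  - by apply: is_cvg_geometric_series; rewrite ger0_norm// invf_lt1// ltr1n.
have h1 := H (fun k => Re (u k)) (fun k => le_trans (ler_Re_cmod _) (uM k)).
have h2 := H (fun k => Im (u k)) (fun k => le_trans (ler_Im_cmod _) (uM k)).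
exists (lim (series (fun k => Re (u k)) @ \oo) +i* lim (series (fun k => Im (u k)) @ \oo)).
apply/ccvg_ReIm; split.
  by under eq_fun do rewrite Re_sum; exact: h1.
by under eq_fun do rewrite Im_sum; exact: h2.
Qed.

Lemma geom_tail u (M : R) l N : (forall k, cmod (u k) <= M / 2 ^+ k) ->
  ccvg (fun n => \sum_(0 <= k < n) u k) l ->
  cmod (l - \sum_(0 <= k < N) u k) <= 2 * M / 2 ^+ N.
Proof.
move=> uM ul.
apply: (@ccvg_le (fun n => \sum_(0 <= k < n) u k - \sum_(0 <= k < N) u k) _ _ N).
  by move=> n; exact: geom_partial_le.
by apply: ccvgB => //; exact: ccvg_cst.
Qed.

Lemma hasps_unique_fun f g (a : nat -> C) : hasps f a -> hasps g a -> f = g.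
Proof. by move=> fa ga; apply/funext => z; exact: ccvg_unique (fa z) (ga z). Qed.

Lemma hasps_ext f g (a b : nat -> C) : f =1 g -> a =1 b -> hasps f a -> hasps g b.
Proof. by move=> /funext -> /funext ->. Qed.

Lemma hasps_lin (c : C) f g (a b : nat -> C) : hasps f a -> hasps g b ->
  hasps (fun z => c * f z + g z) (fun n => c * a n + b n).
Proof.
move=> fa gb z; have := ccvgD (ccvgZ c (fa z)) (gb z).
congr ccvg; apply/funext => n; rewrite big_distrr -big_split /=.
by apply: eq_bigr => k _; ring.
Qed.

(** Infinite radius of convergence, stated as bounded terms at every radius. *)
Definition fastdec (a : nat -> C) : Prop :=
  forall r : R, 0 <= r -> exists M, forall n, cmod (a n) * r ^+ n <= M.

(** The terms at [r] are differences of consecutive partial sums, so they tend to 0 and are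
    bounded. *)
Lemma hasps_fastdec f a : hasps f a -> fastdec a.
Proof.
move=> fa r r0; have := fa r%:C; set S := fun n => \sum_(0 <= k < n) a k * r%:C ^+ k.
move=> fr; have : ccvg (fun n => S n.+1 - S n) (f r%:C - f r%:C).
  by apply: ccvgB => //; rewrite /ccvg (cvg_shiftS (fun n => cmod (S n - f r%:C))).
rewrite subrr => /ccvg_cmod h.
have /cvg_seq_bounded[M [_ hM]] : cvgn (fun n => cmod (S n.+1 - S n)).
  by apply/cvg_ex; eexists; exact: h.
exists (M + 1) => n.
have := hM (M + 1); rewrite ltrDl ltr01 => /(_ isT n Logic.I) /=.
rewrite ger0_norm ?cmod_ge0// /S big_nat_recr//= [X in cmod X]addrC addrA.
by rewrite addNr add0r cmodM cmodX cmodC ger0_norm.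
Qed.

(** Boundedness at radius 2 r is geometric decay at radius r. *)
Lemma fastdec_geom a (r : R) : fastdec a -> 0 <= r ->
  exists M, forall k, cmod (a k) * r ^+ k <= M / 2 ^+ k.
Proof.
move=> fa r0; have [M hM] := fa (2 * r) (mulr_ge0 (ler0n _ 2) r0).
exists M => k; rewrite ler_pdivlMr ?exprn_gt0//.
by have := hM k; rewrite exprMn mulrCA (mulrC (2 ^+ k)).
Qed.

(** One binomial term of the right side; it bounds the derived series by the original one at radius
    1 + x. *)
Lemma deriv_term_le (x : R) k : 0 <= x -> k%:R * x ^+ k.-1 <= (1 + x) ^+ k.
Proof.
move=> x0; elim: k => [|k IH]; first by rewrite mul0r expr0.
case: k IH => [_|k IH].
  by rewrite /= expr0 mulr1 expr1 lerDl.
rewrite /= in IH *; rewrite -natr1 mulrDl mul1r (exprS (1 + x) k.+1) mulrDl mul1r addrC.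
apply: lerD.
  by rewrite lerXn2r ?nnegrE ?addr_ge0// lerDr.
by rewrite exprS mulrCA ler_wpM2l.
Qed.

(** The base |z| + 2 makes the induction close: |z + h| <= |z| + 1 multiplies the old remainder, and
    the derivative term adds one more. *)
Lemma pow_taylor1 (z h : C) k : cmod h <= 1 ->
  cmod ((z + h) ^+ k - z ^+ k - h * (k%:R * z ^+ k.-1)) <=
  cmod h ^+ 2 * (cmod z + 2) ^+ k.
Proof.
move=> h1; elim: k => [|k IH].
  by rewrite !expr0 mul0r mulr0 subrr subr0 cmod0 mulr1 sqr_ge0.
have -> : (z + h) ^+ k.+1 - z ^+ k.+1 - h * (k.+1%:R * z ^+ k) =
   h ^+ 2 * (k%:R * z ^+ k.-1) + (z + h) * ((z + h) ^+ k - z ^+ k - h * (k%:R * z ^+ k.-1)).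
  by rewrite -natr1; case: k {IH} => [|k] /=; rewrite ?expr0 ?mul0r; [ring|rewrite !exprS; ring].
rewrite (le_trans (ler_cmodD _ _))// (cmodM (h ^+ 2)) (cmodM k%:R) (cmodM (z + h)) !cmodX.
have z0 := cmod_ge0 z.
have kR : cmod (k%:R : C) = k%:R.
  by rewrite -[k%:R : C](rmorph_nat (real_complex R)) cmodC ger0_norm.
rewrite kR.
have a1 := deriv_term_le k z0.
have a2 : (1 + cmod z) ^+ k <= (cmod z + 2) ^+ k.
  by rewrite lerXn2r ?nnegrE ?addr_ge0//; lra.
have a3 : cmod (z + h) <= cmod z + 1.
  by rewrite (le_trans (ler_cmodD _ _))// lerD2l.
have a4 : 0 <= cmod h ^+ 2 by rewrite sqr_ge0.
have b1 : cmod h ^+ 2 * (k%:R * cmod z ^+ k.-1) <= cmod h ^+ 2 * (cmod z + 2) ^+ k.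
  by rewrite ler_wpM2l// (le_trans a1).
have b2 := ler_pM (cmod_ge0 _) (cmod_ge0 _) a3 IH.
rewrite (le_trans (lerD b1 b2))// (exprS (cmod z + 2) k) le_eqVlt; apply/orP; left; apply/eqP; ring.
Qed.

(** Termwise differentiation: the second-order remainders of the monomials sum to at most 2 M |h|^2.
    The limit function in the compactness proof is built this way. *)
Lemma fastdec_entire a : fastdec a -> exists2 f, entire f & hasps f a.
Proof.
move=> fa.
have fz z : exists l, ccvg (fun n => \sum_(0 <= k < n) a k * z ^+ k) l.
  have [M hM] := fastdec_geom fa (cmod_ge0 z).
  by apply: (@geom_ccvg _ M) => k; rewrite cmodM cmodX.
have [f hf] := choice fz; exists f => // z.
have [l hl] : exists l, ccvg (fun n => \sum_(0 <= k < n) a k * (k%:R * z ^+ k.-1)) l.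
  have [M hM] := fastdec_geom fa (addr_ge0 ler01 (cmod_ge0 z)).
  apply: (@geom_ccvg _ M) => k; rewrite cmodM; apply: le_trans (hM k).
  rewrite ler_wpM2l ?cmod_ge0// cmodM cmodX.
  rewrite -[k%:R : C](rmorph_nat (real_complex R)) cmodC ger0_norm//.
  exact: deriv_term_le (cmod_ge0 z).
have [M hM] := fastdec_geom fa (addr_ge0 (cmod_ge0 z) (ler0n R 2)).
have M0 : 0 <= M.
  by have := hM 0%N; rewrite !expr0 divr1 mulr1; apply: le_trans; exact: cmod_ge0.
exists l => e e0; exists (Num.min 1 (e / (2 * M + 1))); split.
  by rewrite lt_min ltr01 divr_gt0// ltr_wpDl// mulr_ge0.
move=> h; rewrite lt_min => /and3P[h0 h1 he].
have hn0 : h != 0 by rewrite -cmod_gt0.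
have main : cmod (f (z + h) - f z - h * l) <= 2 * M * cmod h ^+ 2.
  apply: (@ccvg_le (fun n => \sum_(0 <= k < n) a k * (z + h) ^+ k -
     \sum_(0 <= k < n) a k * z ^+ k - h * \sum_(0 <= k < n) a k * (k%:R * z ^+ k.-1)) _ _ 0).
    move=> n _; rewrite big_distrr /= -!sumrB.
    have := @geom_partial_le (fun k => a k * (z + h) ^+ k - a k * z ^+ k -
      h * (a k * (k%:R * z ^+ k.-1))) (M * cmod h ^+ 2) 0 n.
    rewrite (@big_geq _ _ _ 0 0)// subr0 expr0 divr1 => H; rewrite -[leRHS]mulrA; apply: H => // k.
    have -> : a k * (z + h) ^+ k - a k * z ^+ k - h * (a k * (k%:R * z ^+ k.-1)) =
      a k * ((z + h) ^+ k - z ^+ k - h * (k%:R * z ^+ k.-1)) by ring.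
    rewrite cmodM (le_trans (ler_wpM2l (cmod_ge0 _) (pow_taylor1 z k (ltW h1))))//.
    by rewrite mulrCA [leRHS]mulrAC [leRHS]mulrC ler_wpM2l// sqr_ge0.
  by apply: ccvgB; [apply: ccvgB|apply: ccvgZ].
have -> : (f (z + h) - f z) / h - l = (f (z + h) - f z - h * l) / h by field.
rewrite cmodM cmodV ltr_pdivrMr//; apply: le_lt_trans main _.
rewrite expr2 mulrA ltr_pM2r//.
move: he; rewrite ltr_pdivlMr; last by rewrite ltr_wpDl// mulr_ge0.
by apply: le_lt_trans; rewrite mulrC ler_wpM2l ?cmod_ge0// lerDl.
Qed.

End PowerSeries.

(** * Parseval's identity in the Fock space *)

Section AreaRotation.
Local Open Scope complex_scope.
Variable R : realType.
Local Notation leb := (@lebesgue_measure R).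

Lemma integral_translate (G : R -> R) (c : R) : continuous G ->
  (forall x, 0 <= G x) ->
  (\int[leb]_x (G (x + c)%R)%:E = \int[leb]_x (G x)%:E)%E.
Proof.
move=> cG G0; pose F (x : R) := x + c.
have dF (x : R) : is_derive x 1 F 1.
  by have := is_deriveD (is_derive_id x (1 : R)) (is_derive_cst c x 1); rewrite addr0.
have F'E : derive1 F = cst 1.
  by apply/funext => x; rewrite derive1E; by case: (dF x) => _ ->.
rewrite [RHS](@increasing_ge0_integration_by_substitutionT _ F)//.
- by apply: eq_integral => x _; rewrite F'E /= mulr1.
- by move=> x y xy; rewrite /F ltrD2r.
- by rewrite F'E; exact: cst_continuous.
- by rewrite F'E; exact: is_cvg_cst.
- by rewrite F'E; exact: is_cvg_cst.
- apply/cvgrNyPle => A; near=> x; rewrite /F -lerBrDr.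
  by near: x; exact: nbhs_ninfty_le (num_real _).
- apply/cvgryPge => A; near=> x; rewrite /F -lerBlDr.
  by near: x; exact: nbhs_pinfty_ge (num_real _).
Unshelve. all: by end_near. Qed.

Lemma cvg_pairR (T : topologicalType) (f g : T -> R) (p : T) (a b : R) :
  f q @[q --> p] --> a -> g q @[q --> p] --> b -> (f q, g q) @[q --> p] --> (a, b).
Proof. by move=> fa gb; exact: (cvg_pair fa gb). Qed.

(** Measurability and sign serve Tonelli, continuity serves the substitution in
    [integral_translate]; shears preserve all three. *)
Definition nice (G : R * R -> R) : Prop :=
  [/\ continuous G, measurable_fun [set: R * R] G & forall p, 0 <= G p].

Definition shear1 (a : R) (p : R * R) := (p.1 + a * p.2, p.2).
Definition shear2 (a : R) (p : R * R) := (p.1, p.2 + a * p.1).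

Lemma area_fubini1 (G : R * R -> R) : measurable_fun setT G -> (forall p, 0 <= G p) ->
  (\int[@area R]_p (G p)%:E = \int[leb]_x \int[leb]_y (G (x, y))%:E)%E.
Proof.
move=> mG G0; have mE : measurable_fun setT (EFin \o G) by exact/measurable_EFinP.
have := @fubini_tonelli1 _ _ _ _ R leb leb (EFin \o G) mE.
by apply => p; rewrite lee_fin.
Qed.

Lemma area_fubini2 (G : R * R -> R) : measurable_fun setT G -> (forall p, 0 <= G p) ->
  (\int[@area R]_p (G p)%:E = \int[leb]_y \int[leb]_x (G (x, y))%:E)%E.
Proof.
move=> mG G0; have mE : measurable_fun setT (EFin \o G) by exact/measurable_EFinP.
have := @fubini_tonelli2 _ _ _ _ R leb leb (EFin \o G) mE.
by apply => p; rewrite lee_fin.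
Qed.

Lemma nice_shear1 a G : nice G -> nice (G \o shear1 a).
Proof.
move=> [cG mG G0]; split => [p||p]; last exact: G0.
  apply: continuous_comp; last exact: cG.
  apply: cvg_pairR => /=; last exact: cvg_snd.
  by apply: cvgD; [exact: cvg_fst|apply: cvgM; [exact: cvg_cst|exact: cvg_snd]].
apply: measurableT_comp => //; apply: measurable_fun_pair; last exact: measurable_snd.
apply: measurable_funD; first exact: measurable_fst.
by apply: measurable_funM => //; exact: measurable_snd.
Qed.

Lemma nice_shear2 a G : nice G -> nice (G \o shear2 a).
Proof.
move=> [cG mG G0]; split => [p||p]; last exact: G0.
  apply: continuous_comp; last exact: cG.
  apply: cvg_pairR => /=; first exact: cvg_fst.
  by apply: cvgD; [exact: cvg_snd|apply: cvgM; [exact: cvg_cst|exact: cvg_fst]].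
apply: measurableT_comp => //; apply: measurable_fun_pair; first exact: measurable_fst.
apply: measurable_funD; first exact: measurable_snd.
by apply: measurable_funM => //; exact: measurable_fst.
Qed.

(** For fixed y the shear is a translation in x. *)
Lemma integral_shear1 a G : nice G ->
  (\int[@area R]_p (G (shear1 a p))%:E = \int[@area R]_p (G p)%:E)%E.
Proof.
move=> nG; have [cG mG G0] := nG; have [_ mG' G0'] := nice_shear1 a nG.
rewrite (area_fubini2 mG' G0') (area_fubini2 mG G0).
apply: eq_integral => y _; rewrite /shear1 /=.
apply: (@integral_translate (fun x => G (x, y)) (a * y)) => // x.
have h : (z, y) @[z --> x] --> (x, y) by apply: cvg_pairR; [exact: cvg_id|exact: cvg_cst].
exact: (cvg_comp _ G h (cG _)).
Qed.

Lemma integral_shear2 a G : nice G ->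
  (\int[@area R]_p (G (shear2 a p))%:E = \int[@area R]_p (G p)%:E)%E.
Proof.
move=> nG; have [cG mG G0] := nG; have [_ mG' G0'] := nice_shear2 a nG.
rewrite (area_fubini1 mG' G0') (area_fubini1 mG G0).
apply: eq_integral => x _; rewrite /shear2 /=.
apply: (@integral_translate (fun y => G (x, y)) (a * x)) => // y.
have h : (x, z) @[z --> y] --> (x, y) by apply: cvg_pairR; [exact: cvg_cst|exact: cvg_id].
exact: (cvg_comp _ G h (cG _)).
Qed.

(* A rotation of angle different from pi is a product of three shears. *)
Lemma integral_rotation (c s : R) G : c ^+ 2 + s ^+ 2 = 1 -> c != -1 -> nice G ->
  (\int[@area R]_p (G (c * p.1 - s * p.2, s * p.1 + c * p.2))%:E =
   \int[@area R]_p (G p)%:E)%E.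
Proof.
move=> cs c1 nG; have c10 : 1 + c != 0 by rewrite addrC addr_eq0.
(* For c = cos x and s = sin x this is -tan(x/2), whose pole is the excluded angle. *)
pose t := - (s / (1 + c)).
have ts : t * s = c - 1.
  rewrite /t mulNr mulrAC -expr2; have -> : s ^+ 2 = (1 - c) * (1 + c).
    by rewrite -subr_sqr expr1n -cs [X in X - _]addrC addrK.
  by rewrite mulfK// opprB.
have tc : t * (1 + c) = - s by rewrite /t mulNr divfK.
rewrite -[RHS](integral_shear1 t nG) -[RHS](integral_shear2 s (nice_shear1 t nG)).
rewrite -[RHS](integral_shear1 t (nice_shear2 s (nice_shear1 t nG))).
apply: eq_integral => -[x y] _ /=; congr (G _)%:E; rewrite /shear1 /shear2 /=.
have e2 : y + s * (x + t * y) = s * x + c * y.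
  have -> : c = 1 + t * s by rewrite ts; ring.
  ring.
rewrite e2; congr pair.
have -> : x + t * y + t * (s * x + c * y) = (1 + t * s) * x + t * (1 + c) * y by ring.
by rewrite ts tc; ring.
Qed.

End AreaRotation.

(** * Roots of unity and the discrete Fourier transform *)

Section RootsOfUnity.
Local Open Scope complex_scope.
Variable R : realType.
Local Notation C := R[i].

Definition unity_root (N : nat) : C := cexp (0 +i* (pi *+ 2 / N%:R)).
Local Notation omega := unity_root.

Lemma cmod_unity_root N : cmod (omega N) = 1.
Proof. by rewrite cmod_cexp /= expR0. Qed.

Lemma unity_root_neq0 N : omega N != 0.
Proof. exact: cexp_neq0. Qed.

Lemma unity_rootX N k : omega N ^+ k = cexp (0 +i* (pi *+ 2 * (k%:R / N%:R))).
Proof.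
rewrite -cexpMn; congr cexp.
have -> : (0 +i* (pi *+ 2 / N%:R) : C) *+ k = (0 +i* ((pi *+ 2 / N%:R) *+ k)).
  move: (pi *+ 2 / N%:R) => x; elim: k => [|k IH]; first by rewrite !mulr0n.
  by rewrite !mulrS IH; apply: ReIm_inj; rewrite ?(cReD, cImD) /= ?addr0.
by congr Complex; rewrite -mulr_natr -mulrA (mulrC N%:R^-1).
Qed.

Lemma unity_rootN N : (0 < N)%N -> omega N ^+ N = 1.
Proof.
move=> N0; rewrite unity_rootX divff ?pnatr_eq0 -?lt0n// mulr1.
by rewrite -[X in cexp X]add0r cexp2pi cexp0.
Qed.

(** If cos(2 pi t) = 1, the double angle formula gives sin(pi t) = 0, impossible for 0 < t < 1. *)
Lemma unity_root_prim N k : (0 < k < N)%N -> omega N ^+ k != 1.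
Proof.
move=> /andP[k0 kN]; rewrite unity_rootX; set t := k%:R / N%:R.
have N0 : (0 < N)%N by rewrite (leq_ltn_trans _ kN).
have t0 : 0 < t by rewrite divr_gt0// ltr0n.
have t1 : t < 1 by rewrite ltr_pdivrMr ?ltr0n// mul1r ltr_nat.
apply/eqP => /(congr1 (@complex.Re R)); rewrite /cexp cReM /= expR0 mul0r subr0 mul1r.
rewrite mulrnAl cos_mulr2n => e.
have c1 : cos (pi * t) ^+ 2 = 1 by lra.
have : 0 < sin (pi * t) by rewrite sin_gt0_pi// mulr_gt0 ?pi_gt0//= gtr_pMr ?pi_gt0.
have := cos2Dsin2 (pi * t); rewrite c1 => /eqP; rewrite -subr_eq0 addrAC subrr add0r.
by rewrite expf_eq0 /= => /eqP ->; rewrite ltxx.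
Qed.

Lemma unity_root_sum N (j k : nat) : (j < N)%N -> (k < N)%N ->
  \sum_(r < N) (omega N ^+ j / omega N ^+ k) ^+ r = if j == k then N%:R else 0.
Proof.
move=> jN kN; have N0 : (0 < N)%N by rewrite (leq_ltn_trans _ kN).
have wn0 i : omega N ^+ i != 0 by rewrite expf_neq0// unity_root_neq0.
case: eqP => [->|/eqP jk].
  under eq_bigr do rewrite divff// expr1n.
  by rewrite sumr_const card_ord.
set rho := omega N ^+ j / omega N ^+ k.
have rho1 : rho != 1.
  rewrite /rho; apply/eqP => /(congr1 (fun x => x * omega N ^+ k)).
  rewrite divfK// mul1r => e.
  case: (ltngtP j k) jk => // h _.
    move: e; rewrite -(subnKC (ltnW h)) exprD -[LHS]mulr1 => /(mulfI (wn0 _))/esym/eqP.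
    by apply/negP/unity_root_prim; rewrite subn_gt0 h (leq_ltn_trans _ kN)// leq_subr.
  move: e; rewrite -(subnKC (ltnW h)) exprD -[RHS]mulr1 => /(mulfI (wn0 _))/eqP.
  by apply/negP/unity_root_prim; rewrite subn_gt0 h (leq_ltn_trans _ jN)// leq_subr.
have rhoN : rho ^+ N = 1.
  by rewrite /rho expr_div_n -!exprM !(mulnC _ N) !exprM unity_rootN// !expr1n divr1.
apply/eqP; have := subrX1 rho N; rewrite rhoN subrr => /esym/eqP.
by rewrite mulf_eq0 subr_eq0 (negbTE rho1).
Qed.

Lemma cmod_sqrC (z : C) : (cmod z ^+ 2)%:C = z * conjc z.
Proof. by rewrite cmod_sqr; case: z => a b; apply: ReIm_inj => /=; ring. Qed.

Lemma unity_root_conj N : conjc (omega N) = (omega N)^-1.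
Proof.
apply: (mulfI (unity_root_neq0 N)).
by rewrite -cmod_sqrC cmod_unity_root expr1n divff// unity_root_neq0.
Qed.

(** Expand the squares and sum over [r] first: orthogonality leaves the diagonal k = j. *)
Lemma plancherel N (v : nat -> C) : (0 < N)%N ->
  \sum_(r < N) cmod (N%:R^-1 * \sum_(k < N) (omega N)^-1 ^+ (k * r) * v k) ^+ 2
  = N%:R^-1 * \sum_(k < N) cmod (v k) ^+ 2.
Proof.
move=> N0; apply: (@complexI R).
have NC0 : (N%:R : C) != 0 by rewrite pnatr_eq0 -lt0n.
rewrite rmorphM rmorphV ?unitfE ?pnatr_eq0 -?lt0n// rmorph_nat !rmorph_sum /=.
transitivity (\sum_(r < N) \sum_(k < N) \sum_(j < N) (N%:R^-1 * N%:R^-1) * (v k * conjc (v j))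
   * (omega N ^+ j / omega N ^+ k) ^+ r).
  apply: eq_bigr => r _; rewrite cmod_sqrC rmorphM fmorphV rmorph_nat rmorph_sum /=.
  rewrite mulrACA big_distrlr /= big_distrr /=; apply: eq_bigr => k _.
  rewrite big_distrr /=; apply: eq_bigr => j _.
  rewrite rmorphM rmorphXn fmorphV.
  transitivity (N%:R^-1 * N%:R^-1 * ((omega N)^-1 ^+ (k * r) * v k *
    ((conjc (omega N))^-1 ^+ (j * r) * conjc (v j)))); first by [].
  rewrite unity_root_conj invrK !exprVn.
  by rewrite expr_div_n -!exprM; ring.
rewrite exchange_big /= big_distrr /=; apply: eq_bigr => k _.
rewrite exchange_big /= (bigD1 k)//= [X in _ + X]big1 => [|j jk].
  by rewrite addr0 -mulr_sumr unity_root_sum// eqxx cmod_sqrC; field.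
by rewrite -mulr_sumr unity_root_sum// ifN ?mulr0.
Qed.

End RootsOfUnity.

(** * Power series under rotations and finite averages *)

Section FiniteSums.
Local Open Scope complex_scope.
Variable R : realType.
Local Notation C := R[i].
Implicit Types (a : nat -> C).

Lemma hasps_poly a N :
  hasps (fun z => \sum_(0 <= k < N) a k * z ^+ k) (fun k => if (k < N)%N then a k else 0).
Proof.
move=> z; apply: cvg_near_cst; near=> n.
have Nn : (N <= n)%N by near: n; exact: nbhs_infty_ge.
suff -> : \sum_(0 <= k < n) (if (k < N)%N then a k else 0) * z ^+ k =
    \sum_(0 <= k < N) a k * z ^+ k by rewrite subrr cmod0.
rewrite (@big_cat_nat _ _ _ N)//= [X in _ + X]big_nat_cond [X in _ + X]big1 => [|k].
  by rewrite addr0; apply: eq_big_nat => k /andP[_ ->].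
by rewrite andbT => /andP[Nk _]; rewrite ltnNge Nk mul0r.
Unshelve. all: by end_near. Qed.

Lemma hasps_scale (f : C -> C) a (w : C) :
  hasps f a -> hasps (fun z => f (w * z)) (fun k => a k * w ^+ k).
Proof.
move=> fa z; have := fa (w * z); apply: cvg_trans; apply: near_eq_cvg; near=> n.
by congr (cmod (_ - _)); apply: eq_bigr => k _; rewrite exprMn; ring.
Unshelve. all: by end_near. Qed.

Lemma hasps_sum (N : nat) (c : nat -> C) (g : nat -> C -> C) (b : nat -> nat -> C) :
  (forall k, hasps (g k) (b k)) ->
  hasps (fun z => \sum_(k < N) c k * g k z) (fun n => \sum_(k < N) c k * b k n).
Proof.
move=> gb; elim: N => [|N IH].
  move=> z; apply: cvg_near_cst; near=> n.
  rewrite big_ord0 subr0 big1 ?cmod0// => k _.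
  by rewrite big_ord0 mul0r.
have := hasps_lin (c N) (gb N) IH.
congr hasps; apply/funext => z; rewrite big_ord_recr/= addrC//.
Unshelve. all: by end_near. Qed.

Lemma hasps_entire (f : C -> C) a : hasps f a -> entire f.
Proof.
move=> fa; have [g eg ga] := fastdec_entire (hasps_fastdec fa).
by rewrite (hasps_unique_fun fa ga).
Qed.

(* Keeps the Taylor terms of f whose degree is congruent to r modulo N. *)
Definition favg N r (f : C -> C) (z : C) : C :=
  N%:R^-1 * \sum_(k < N) (unity_root R N)^-1 ^+ (k * r) * f (unity_root R N ^+ k * z).

(** Among exponents below N only r is congruent to r modulo N. *)
Lemma favg_poly N r a z : (r < N)%N ->
  favg N r (fun z => \sum_(0 <= n < N) a n * z ^+ n) z = a r * z ^+ r.
Proof.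
move=> rN; have N0 : (0 < N)%N by rewrite (leq_ltn_trans _ rN).
have NC0 : (N%:R : C) != 0 by rewrite pnatr_eq0 -lt0n.
rewrite /favg.
transitivity (N%:R^-1 * \sum_(n < N) a n * z ^+ n *
   (\sum_(k < N) (unity_root R N ^+ n / unity_root R N ^+ r) ^+ k)).
  congr (_ * _); under [RHS]eq_bigr do rewrite mulr_sumr.
  rewrite exchange_big /=; apply: eq_bigr => k _; rewrite big_mkord mulr_sumr.
  apply: eq_bigr => n _; rewrite exprMn !exprVn expr_div_n -!exprM.
  by rewrite (mulnC k r) (mulnC k n); ring.
rewrite (bigD1 (Ordinal rN))//= unity_root_sum// eqxx [X in _ + X]big1 => [|n nr].
  by rewrite addr0; field.
by rewrite unity_root_sum// ifN ?mulr0.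
Qed.

(** [favg] averages values at points of modulus |z| with unimodular weights, so replacing [f] by its
    Taylor polynomial costs at most the tail there. *)
Lemma favg_near N r a f (M : R) z : (r < N)%N ->
  (forall k, cmod (a k) * cmod z ^+ k <= M / 2 ^+ k) -> hasps f a ->
  cmod (favg N r f z - a r * z ^+ r) <= 2 * M / 2 ^+ N.
Proof.
move=> rN aM fa; have N0 : (0 < N)%N by rewrite (leq_ltn_trans _ rN).
have NR0 : (N%:R : R) != 0 by rewrite pnatr_eq0 -lt0n.
have NC : cmod (N%:R : C) = N%:R.
  by rewrite -[N%:R : C](rmorph_nat (real_complex R)) cmodC ger0_norm.
rewrite -(favg_poly a z rN) /favg -mulrBr -sumrB cmodM cmodV NC.
rewrite ler_pdivrMl ?ltr0n// (le_trans (ler_cmod_sum _ _ _))//.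
have -> : N%:R * (2 * M / 2 ^+ N) = \sum_(k < N) (2 * M / 2 ^+ N).
  by rewrite sumr_const card_ord -[RHS]mulr_natl.
apply: ler_sum => k _; rewrite -mulrBr cmodM cmodX cmodV cmod_unity_root invr1 expr1n mul1r.
apply: (@geom_tail _ (fun n => a n * (unity_root R N ^+ k * z) ^+ n) M) => [n|].
  by rewrite cmodM cmodX cmodM cmodX cmod_unity_root expr1n mul1r.
exact: fa.
Qed.

End FiniteSums.

(** * The weighted norm and its decomposition modulo N *)

Section Parseval.
Local Open Scope complex_scope.
Variable R : realType.
Local Notation C := R[i].
Local Notation Re := (@complex.Re R).
Local Notation Im := (@complex.Im R).
Variable alpha : R.
Implicit Types (f g : C -> C) (a : nat -> C).

Definition dens f (p : R * R) : R :=
  cmod (f (p.1 +i* p.2)) ^+ 2 * expR (- alpha * (p.1 ^+ 2 + p.2 ^+ 2)).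
Definition wnorm f : \bar R := (\int[@area R]_p (dens f p)%:E)%E.

Lemma fock_norm2E f : fock_norm2 alpha f = ((alpha / pi)%:E * wnorm f)%E.
Proof. by []. Qed.

Lemma dens_ge0 f p : 0 <= dens f p.
Proof. by rewrite mulr_ge0 ?sqr_ge0 ?expR_ge0. Qed.

Definition cmeas (F : R * R -> C) : Prop :=
  measurable_fun setT (fun p => Re (F p)) /\ measurable_fun setT (fun p => Im (F p)).

Lemma cmeas_cst (c : C) : cmeas (fun=> c). Proof. by split. Qed.
Lemma cmeasD F G : cmeas F -> cmeas G -> cmeas (fun p => F p + G p).
Proof.
move=> [a b] [c d]; split.
  by under eq_fun do rewrite cReD; exact: measurable_funD.
by under eq_fun do rewrite cImD; exact: measurable_funD.
Qed.
Lemma cmeasM F G : cmeas F -> cmeas G -> cmeas (fun p => F p * G p).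
Proof.
move=> [a b] [c d]; split.
  under eq_fun do rewrite cReM.
  by apply: measurable_funB; apply: measurable_funM.
under eq_fun do rewrite cImM.
by apply: measurable_funD; apply: measurable_funM.
Qed.
Lemma cmeas_mkc : cmeas (@mkc R).
Proof. by split; [exact: measurable_fst|exact: measurable_snd]. Qed.

Lemma cmeas_poly a N : cmeas (fun p => \sum_(0 <= k < N) a k * mkc p ^+ k).
Proof.
elim: N => [|N IH].
  under eq_fun do rewrite big_geq//; exact: cmeas_cst.
under eq_fun do rewrite big_nat_recr//=.
apply: cmeasD => //; apply: cmeasM; first exact: cmeas_cst.
elim: N {IH} => [|N IH]; first by under eq_fun do rewrite expr0; exact: cmeas_cst.
by under eq_fun do rewrite exprS; apply: cmeasM => //; exact: cmeas_mkc.
Qed.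

Lemma hasps_cmeas f a : hasps f a -> cmeas (f \o @mkc R).
Proof.
move=> fa; split.
  apply: (@measurable_fun_cvg _ _ _ _ (fun n p => Re (\sum_(0 <= k < n) a k * mkc p ^+ k))).
    by move=> n; case: (cmeas_poly a n).
  by move=> p _; case/ccvg_ReIm: (fa (mkc p)).
apply: (@measurable_fun_cvg _ _ _ _ (fun n p => Im (\sum_(0 <= k < n) a k * mkc p ^+ k))).
  by move=> n; case: (cmeas_poly a n).
by move=> p _; case/ccvg_ReIm: (fa (mkc p)).
Qed.

Lemma hasps_nice f a : hasps f a -> nice (dens f).
Proof.
move=> fa; have ef := hasps_entire fa; have [m1 m2] := hasps_cmeas fa.
split => [p||p]; last exact: dens_ge0.
  apply: cvgM.
    rewrite expr2; under eq_fun do rewrite expr2.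
    have cf : ccont (f \o @mkc R) p.
      by have := cdiff_cont (entire_cdiff (mkc p) ef); rewrite mkcK.
    by have := cmod_cont cf => h; apply: cvgM.
  apply: (@cvg_comp _ _ _ _ (@expR R)); last exact: continuous_expR.
  apply: cvgM; first exact: cvg_cst.
  rewrite !expr2; under eq_fun do rewrite !expr2.
  by apply: cvgD; apply: cvgM; (exact: cvg_fst || exact: cvg_snd).
have -> : dens f = fun p => (Re (f (mkc p)) ^+ 2 + Im (f (mkc p)) ^+ 2) *
    expR (- alpha * (p.1 ^+ 2 + p.2 ^+ 2)).
  by apply/funext => p; rewrite /dens cmod_sqr.
apply: measurable_funM.
  by apply: measurable_funD; apply: measurable_funX.
apply: measurableT_comp => //; apply: measurable_funM => //.
apply: measurable_funD; apply: measurable_funX;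
  [exact: measurable_fst|exact: measurable_snd].
Qed.

Lemma hasps_dens_measurable f a : hasps f a -> measurable_fun setT (EFin \o dens f).
Proof. by move=> /hasps_nice[_ m _]; exact/measurable_EFinP. Qed.

Lemma wnorm_rotate f a (w : C) : hasps f a -> cmod w = 1 -> w != -1 ->
  wnorm (fun z => f (w * z)) = wnorm f.
Proof.
move=> fa w1 wN1; have e1 : Re w ^+ 2 + Im w ^+ 2 = 1 by rewrite -cmod_sqr w1 expr1n.
have c1 : Re w != -1.
  apply: contraNneq wN1 => rw; move: e1; rewrite rw sqrrN expr1n => /eqP.
  rewrite -subr_eq0 addrAC subrr add0r expf_eq0 /= => /eqP iw.
  by apply/eqP; apply: ReIm_inj; rewrite ?rw ?iw /= ?oppr0.
rewrite -[RHS](integral_rotation e1 c1 (hasps_nice fa)).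
apply: eq_integral => -[x y] _; rewrite /dens /=; congr (_ * expR (_ * _))%:E.
  by congr (cmod (f _) ^+ 2); apply: ReIm_inj; rewrite ?(cReM, cImM) /= 1?addrC.
have -> : (Re w * x - Im w * y) ^+ 2 + (Im w * x + Re w * y) ^+ 2 =
   (Re w ^+ 2 + Im w ^+ 2) * (x ^+ 2 + y ^+ 2) by ring.
by rewrite e1 mul1r.
Qed.

(** A power of the root may be -1, where the shears fail, so the rotation by the root itself is
    iterated; 2 < N keeps the root different from -1. *)
Lemma wnorm_rootX f a N k : hasps f a -> (2 < N)%N ->
  wnorm (fun z => f (unity_root R N ^+ k * z)) = wnorm f.
Proof.
move=> fa N2; have wN1 : unity_root R N != -1.
  apply/eqP => w1; have := @unity_root_prim R N 2.
  by rewrite N2 => /(_ isT); rewrite w1 sqrrN expr1n eqxx.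
elim: k => [|k IH]; first by under [in LHS]eq_fun do rewrite expr0 mul1r.
rewrite -{}IH -[RHS](wnorm_rotate (hasps_scale _ fa) (cmod_unity_root R N) wN1).
by congr wnorm; apply/funext => z; rewrite exprSr mulrA.
Qed.

Lemma wnorm_sum (N : nat) (g : nat -> C -> C) (b : nat -> nat -> C) :
  (forall r, hasps (g r) (b r)) ->
  (\int[@area R]_p (\sum_(r < N) dens (g r) p)%:E = \sum_(r < N) wnorm (g r))%E.
Proof.
move=> gb; under eq_integral do rewrite -sumEFin.
rewrite (@ge0_integral_sum _ _ R (@area R) setT measurableT _ (fun (r : 'I_N) p => (dens (g r) p)%:E))//.
- by move=> r; exact: hasps_dens_measurable (gb r).
- by move=> r p _; rewrite lee_fin dens_ge0.
Qed.

Lemma hasps_favg f a N r : hasps f a -> exists b, hasps (favg N r f) b.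
Proof.
move=> fa; pose g k z := f (unity_root R N ^+ k * z).
have gb k : hasps (g k) (fun n => a n * (unity_root R N ^+ k) ^+ n).
  exact: hasps_scale.
have H := hasps_sum N (fun k => N%:R^-1 * (unity_root R N)^-1 ^+ (k * r)) gb.
eexists; suff -> : favg N r f = (fun z => \sum_(k < N) N%:R^-1 *
  (unity_root R N)^-1 ^+ (k * r) * g k z) by exact: H.
apply/funext => z; rewrite /favg mulr_sumr; apply: eq_bigr => k _.
by rewrite mulrA.
Qed.

(** [plancherel] holds pointwise on the orbit of z, and the N rotated copies of [f] on its right
    side have equal norms. *)
Lemma wnorm_favg f a N : hasps f a -> (2 < N)%N ->
  (\sum_(r < N) wnorm (favg N r f))%E = wnorm f.
Proof.
move=> fa N2; have N0 : (0 < N)%N by rewrite (ltn_trans _ N2).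
have [b hb] := choice (fun r => hasps_favg N r fa).
rewrite -(wnorm_sum N hb).
pose g k z := f (unity_root R N ^+ k * z).
have gb k : hasps (g k) (fun n => a n * (unity_root R N ^+ k) ^+ n).
  exact: hasps_scale.
transitivity (\int[@area R]_p ((N%:R^-1)%:E * (\sum_(k < N) dens (g k) p)%:E))%E.
  apply: eq_integral => p _; rewrite -EFinM; congr EFin.
  rewrite /dens -!mulr_suml.
  rewrite (plancherel (fun k => f (unity_root R N ^+ k * (p.1 +i* p.2))) N0).
  by rewrite -mulrA.
rewrite ge0_integralZl//; last 2 first.
- apply/measurable_EFinP; apply: measurable_sum => k.
  by case: (hasps_nice (gb k)).
- by move=> p _; rewrite lee_fin sumr_ge0// => k _; exact: dens_ge0.
rewrite (wnorm_sum N gb) (eq_bigr (fun=> wnorm f)) => [|k _]; last exact: wnorm_rootX fa N2.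
have S n : (\sum_(k < n) wnorm f = n%:R%:E * wnorm f)%E.
  elim: n => [|n IH]; first by rewrite big_ord0 mul0e.
  rewrite big_ord_recr /= IH -natr1 EFinD ge0_muleDl ?mul1e// ?lee_fin//.
by rewrite S muleA -EFinM mulVf ?mul1e// pnatr_eq0 -lt0n.
Qed.

End Parseval.

(** * Parseval's identity and the norms of monomials *)

Section Moments.
Local Open Scope complex_scope.
Variable R : realType.
Local Notation C := R[i].
Local Notation leb := (@lebesgue_measure R).
Variable alpha : R.
Implicit Types (f g : C -> C) (a : nat -> C).
Local Notation dens := (dens alpha).
Local Notation wnorm := (wnorm alpha).

(** Fatou's lemma for a pointwise limit; the shift by [n0] admits bounds that hold only
    eventually. *)
Lemma fatou_bound (g_ : nat -> R * R -> R) (g : R * R -> R) (L : \bar R) n0 :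
  (forall n, measurable_fun setT (g_ n)) -> (forall n p, 0 <= g_ n p) ->
  (forall p, g_ n p @[n --> \oo] --> g p) ->
  (forall n, (n0 <= n)%N -> (\int[@area R]_p (g_ n p)%:E <= L)%E) ->
  (\int[@area R]_p (g p)%:E <= L)%E.
Proof.
move=> mg g0 gg gL.
pose h n p := (g_ (n + n0)%N p)%:E.
have mh n : measurable_fun setT (h n) by exact/measurable_EFinP.
have h0 n p : setT p -> (0 <= h n p)%E by rewrite lee_fin.
have hg p : h n p @[n --> \oo] --> (g p)%:E.
  apply: cvg_EFin; first by near=> n.
  by have := gg p; rewrite -(cvg_shiftn n0).
have := @fatou _ _ R (@area R) setT measurableT h mh h0.
under eq_integral do rewrite (is_cvg_limn_einfE (cvgP _ (hg _))) (cvg_lim _ (hg _))//.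
move=> /le_trans; apply; rewrite limn_einf_lim; apply: lime_le; first exact: is_cvg_einfs.
apply: nearW => n; apply: (@le_trans _ _ (\int[@area R]_p h n p)%E).
  by apply: ereal_inf_lbound; exists n => //=.
by apply: gL; rewrite leq_addl.
Unshelve. all: by end_near. Qed.

Definition moment n : \bar R := wnorm (fun z => z ^+ n).

Lemma hasps_monom n : hasps (fun z : C => z ^+ n) (fun k => (k == n)%:R).
Proof.
have := hasps_poly (fun k => (k == n)%:R : C) n.+1.
have -> : (fun k => if (k < n.+1)%N then (k == n)%:R else 0 : C) = (fun k => (k == n)%:R).
  by apply/funext => k; case: ifPn => //; rewrite -leqNgt => nk; rewrite gtn_eqF.
congr hasps; apply/funext => z; rewrite big_nat_recr//= eqxx mul1r.
rewrite big_nat_cond big1 ?add0r// => k; rewrite andbT => /andP[_ kn].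
by rewrite ltn_eqF// mul0r.
Qed.

Lemma dens_cM (c : C) f p : dens (fun z => c * f z) p = cmod c ^+ 2 * dens f p.
Proof. by rewrite /dens cmodM exprMn mulrA. Qed.

Lemma moment_ge0 n : (0 <= moment n)%E.
Proof. by apply: integral_ge0 => p _; rewrite lee_fin dens_ge0. Qed.

Lemma wnorm_monom (c : C) n : wnorm (fun z => c * z ^+ n) = ((cmod c ^+ 2)%:E * moment n)%E.
Proof.
rewrite /wnorm; under eq_integral do rewrite dens_cM EFinM.
rewrite ge0_integralZl//.
- exact: hasps_dens_measurable (hasps_monom n).
- by move=> p _; rewrite lee_fin dens_ge0.
- by rewrite lee_fin sqr_ge0.
Qed.

Lemma dens_cvg (u : nat -> C -> C) f p :
  ccvg (fun n => u n (p.1 +i* p.2)) (f (p.1 +i* p.2)) ->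
  dens (u n) p @[n --> \oo] --> dens f p.
Proof.
move=> /ccvg_cmod h; apply: cvgM; last exact: cvg_cst.
by rewrite expr2; under eq_fun do rewrite expr2; exact: cvgM.
Qed.

Lemma favg_ccvg f a r z : hasps f a -> ccvg (fun N => favg N r f z) (a r * z ^+ r).
Proof.
move=> fa; have [M hM] := fastdec_geom (hasps_fastdec fa) (cmod_ge0 z).
have e0 : 2 * M / 2 ^+ N @[N --> \oo] --> (0 : R).
  rewrite -(mulr0 (2 * M)); apply: cvgM; first exact: cvg_cst.
  under eq_fun do rewrite -exprVn; apply: cvg_expr.
  by rewrite ger0_norm// invf_lt1// ltr1n.
apply: (squeeze_cvgr _ (cvg_cst 0) e0); near=> N.
have rN : (r < N)%N by near: N; exact: nbhs_infty_gt.
by rewrite cmod_ge0 (favg_near rN hM fa).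
Unshelve. all: by end_near. Qed.

Lemma cvg_sum_ord (u : nat -> nat -> R) (l : nat -> R) M :
  (forall r, u n r @[n --> \oo] --> l r) ->
  \sum_(r < M) u n r @[n --> \oo] --> \sum_(r < M) l r.
Proof.
move=> ul; elim: M => [|M IH].
  by under eq_fun do rewrite big_ord0; rewrite big_ord0; exact: cvg_cst.
by under eq_fun do rewrite big_ord_recr; rewrite big_ord_recr; exact: cvgD.
Qed.

(** Fatou on the first M components [favg N r f], which tend to a_r z^r while their norms never sum
    to more than that of [f]. *)
Lemma parseval_bessel f a M : hasps f a ->
  (\sum_(r < M) (cmod (a r) ^+ 2)%:E * moment r <= wnorm f)%E.
Proof.
move=> fa; under eq_bigr do rewrite -wnorm_monom.
have mb r : hasps (fun z => a r * z ^+ r) (fun k => a r * (k == r)%:R).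
  have h0 := hasps_poly (fun _ : nat => 0 : C) 0.
  have := hasps_lin (a r) (hasps_monom r) h0; congr hasps; apply/funext => z.
    by rewrite big_geq// addr0.
  by rewrite ltn0 addr0.
rewrite -(wnorm_sum alpha M mb).
have fb N r : nice (dens (favg N r f)).
  by have [b hb] := hasps_favg N r fa; exact: hasps_nice hb.
(* N >= M puts these M components among the N of [wnorm_favg], which asks for N >= 3. *)
apply: (@fatou_bound (fun N p => \sum_(r < M) dens (favg N r f) p) _ _ (maxn M 3)).
- by move=> N; apply: measurable_sum => r; case: (fb N r).
- by move=> N p; apply: sumr_ge0 => r _; exact: dens_ge0.
- by move=> p; apply: (@cvg_sum_ord (fun N r => dens (favg N r f) p) (fun r => dens (fun z => a r * z ^+ r) p)) => r; apply: dens_cvg; exact: favg_ccvg.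
move=> N; rewrite geq_max => /andP[MN N3].
have [b hb] := choice (fun r => hasps_favg N r fa).
rewrite (wnorm_sum alpha M hb) -(wnorm_favg alpha fa N3).
rewrite -(big_mkord xpredT (fun r => wnorm (favg N r f))).
rewrite -(big_mkord xpredT (fun r => wnorm (favg N r f))).
apply: lee_sum_nneg_natr => // r _ _.
by apply: integral_ge0 => p _; rewrite lee_fin dens_ge0.
Qed.

Lemma wnorm_poly a N : (2 < N)%N ->
  wnorm (fun z => \sum_(0 <= k < N) a k * z ^+ k) =
  (\sum_(r < N) (cmod (a r) ^+ 2)%:E * moment r)%E.
Proof.
move=> N2; rewrite -(wnorm_favg alpha (hasps_poly a N) N2).
apply: eq_bigr => r _; rewrite -wnorm_monom; congr wnorm; apply/funext => z; exact: favg_poly.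
Qed.

Theorem parseval f a : hasps f a ->
  wnorm f = (\sum_(0 <= n <oo) (cmod (a n) ^+ 2)%:E * moment n)%E.
Proof.
move=> fa; have t0 n : (0 <= (cmod (a n) ^+ 2)%:E * moment n)%E.
  by rewrite mule_ge0 ?moment_ge0// lee_fin sqr_ge0.
apply/eqP; rewrite eq_le; apply/andP; split; last first.
  apply: lime_le; first exact: is_cvg_nneseries.
  by apply: nearW => M; rewrite big_mkord; exact: parseval_bessel.
(* For the upper bound Fatou is applied to the Taylor polynomials, whose norms are known exactly. *)
pose S n z := \sum_(0 <= k < n) a k * z ^+ k.
have nS n : nice (dens (S n)) by exact: hasps_nice (hasps_poly a n).
apply: (@fatou_bound (fun n => dens (S n)) _ _ 3).
- by move=> n; case: (nS n).
- by move=> n p; exact: dens_ge0.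
- by move=> p; apply: dens_cvg; exact: fa.
move=> n n3; rewrite -[leLHS]/(wnorm (S n)) wnorm_poly//.
rewrite -(big_mkord xpredT (fun r => ((cmod (a r) ^+ 2)%:E * moment r)%E)).
exact: nneseries_lim_ge.
Qed.

Hypothesis alpha_gt0 : 0 < alpha.

Lemma exp_decay_bound m : exists2 K : R, 0 <= K &
  forall t, 0 <= t -> (1 + t) ^+ m.+1 * expR (- alpha * t) <= K.
Proof.
(* From e^x >= x^(m+1) / (m+1)! at x = alpha (1 + t). *)
exists (m.+1`!%:R / alpha ^+ m.+1 * expR alpha).
  by rewrite mulr_ge0 ?expR_ge0// divr_ge0// exprn_ge0// ltW.
move=> t t0; have at0 : 0 <= alpha * (1 + t) by rewrite mulr_ge0 ?addr_ge0// ltW.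
have fp : 0 < m.+1`!%:R :> R by rewrite ltr0n fact_gt0.
have h : (alpha * (1 + t)) ^+ m.+1 / m.+1`!%:R <= expR (alpha * (1 + t)).
  by apply: le_trans (expR_ge1Dxn m at0); rewrite lerDr.
move: h; rewrite ler_pdivrMr// exprMn => h.
rewrite mulNr expRN ler_pdivrMr ?expR_gt0//.
have -> : m.+1`!%:R / alpha ^+ m.+1 * expR alpha * expR (alpha * t) =
   expR (alpha * (1 + t)) * m.+1`!%:R / alpha ^+ m.+1.
  by rewrite mulrDr mulr1 expRD; ring.
by rewrite ler_pdivlMr ?exprn_gt0// mulrC.
Qed.

Lemma integral_oneDsqrV : (\int[leb]_x ((oneDsqr x)^-1)%:E = pi%:E)%E.
Proof.
rewrite ge0_symfun_integralT.
- have -> : [set x : R | (0 <= x)%R] = `[0%R, +oo[%classic.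
    by apply/seteqP; split => x /=; rewrite in_itv /= andbT.
  by rewrite integral0y_oneDsqr -EFinM mulrC divfK.
- by move=> x; rewrite invr_ge0 (le_trans _ (oneDsqr_ge1 x)).
- exact: continuous_oneDsqrV.
- by move=> x /=; rewrite /oneDsqr sqrrN.
Qed.

(** The density is dominated by K / ((1 + x^2)(1 + y^2)), a product of integrable functions of one
    variable. *)
Lemma moment_lty n : (moment n < +oo)%E.
Proof.
(* The exponent n + 2 splits into n for |z|^(2n) and 2 for (1 + x^2)(1 + y^2) <= (1 + |z|^2)^2. *)
have [K K0 hK] := exp_decay_bound n.+1.
pose o (x : R) := (oneDsqr x)^-1.
have o0 x : 0 <= o x by rewrite invr_ge0 (le_trans _ (oneDsqr_ge1 x)).
have mo : measurable_fun [set: R] (EFin \o o).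
  by apply/measurable_EFinP; apply: continuous_measurable_fun; exact: continuous_oneDsqrV.
have mo2 : measurable_fun [set: R * R] (fun p => K * o p.1 * o p.2).
  have mo' : measurable_fun [set: R] o by apply/measurable_EFinP.
  have m1 : measurable_fun [set: R * R] (fun p => o p.1).
    exact: measurableT_comp mo' measurable_fst.
  have m2 : measurable_fun [set: R * R] (fun p => o p.2).
    exact: measurableT_comp mo' measurable_snd.
  apply: measurable_funM => //.
  exact: measurable_funM (measurable_cst K) m1.
apply: (@le_lt_trans _ _ (\int[@area R]_p (K * o p.1 * o p.2)%:E)%E).
  apply: ge0_le_integral => //.
  - by move=> p _; rewrite lee_fin dens_ge0.
  - exact: hasps_dens_measurable (hasps_monom n).
  - exact/measurable_EFinP.
  move=> [x y] _; rewrite lee_fin /dens cmodX /= -exprM mulnC exprM cmod_sqr /=.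
  set t := x ^+ 2 + y ^+ 2.
  have t0 : 0 <= t by rewrite addr_ge0// sqr_ge0.
  have ox : 0 < oneDsqr x by rewrite (lt_le_trans _ (oneDsqr_ge1 x)).
  have oy : 0 < oneDsqr y by rewrite (lt_le_trans _ (oneDsqr_ge1 y)).
  rewrite /o ler_pdivlMr// ler_pdivlMr//; apply: le_trans (hK t t0).
  rewrite mulrAC -mulrA mulrAC ler_wpM2r ?expR_ge0//.
  have h1 : oneDsqr y * oneDsqr x <= (1 + t) ^+ 2.
    rewrite /oneDsqr /t -subr_ge0.
    have -> : (1 + (x ^+ 2 + y ^+ 2)) ^+ 2 - (1 + y ^+ 2) * (1 + x ^+ 2) =
      x ^+ 2 + y ^+ 2 + x ^+ 2 * y ^+ 2 + x ^+ 2 ^+ 2 + y ^+ 2 ^+ 2 by ring.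
    by rewrite !addr_ge0 ?sqr_ge0// mulr_ge0 ?sqr_ge0.
  have -> : (1 + t) ^+ n.+2 = (1 + t) ^+ n * (1 + t) ^+ 2 by rewrite -exprD addn2.
  have h2 : t ^+ n <= (1 + t) ^+ n by apply: lerXn2r; rewrite ?nnegrE; lra.
  have h3 : 0 <= oneDsqr y * oneDsqr x by apply: mulr_ge0; exact: ltW.
  have h4 : 0 <= t ^+ n by exact: exprn_ge0.
  by rewrite (mulrC (oneDsqr x)); exact: ler_pM.
rewrite area_fubini1//; last by move=> p; rewrite !mulr_ge0.
have E x : (\int[leb]_y (K * o x * o y)%:E = (K * pi)%:E * (o x)%:E)%E.
  under eq_integral do rewrite EFinM.
  rewrite ge0_integralZl//.
  - by rewrite integral_oneDsqrV -!EFinM; congr EFin; ring.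
  - by move=> y _; rewrite lee_fin.
  - by rewrite lee_fin mulr_ge0.
under eq_integral do rewrite /= E.
rewrite ge0_integralZl//.
- by rewrite integral_oneDsqrV -EFinM ltry.
- by move=> y _; rewrite lee_fin.
- by rewrite lee_fin mulr_ge0// pi_ge0.
Qed.

(* This growth makes every sequence of finite Fock norm the Taylor coefficients of an
   entire function. *)
Lemma moment_ge (r : R) : 0 <= r -> exists2 c : R, 0 < c &
  forall n, ((c * r ^+ n ^+ 2)%:E <= moment n)%E.
Proof.
move=> r0; exists (expR (- alpha * ((r + 1) ^+ 2 + 1))) => [|n]; first exact: expR_gt0.
set c := expR _; have c0 : 0 < c by exact: expR_gt0.
(* A square of area 1 on which r^2 <= |z|^2 <= (r + 1)^2 + 1. *)
pose B : set (R * R) := `[r, r + 1]%classic `*` `[0%R, 1%R]%classic.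
have mB : measurable B by apply: measurableX => //; exact: measurable_itv.
have aB : @area R B = 1%E.
  have l1 : leb `[r, r + 1]%classic = 1%E.
    by rewrite lebesgue_measure_itv /= lte_fin ltrDl ltr01 -EFinB; congr EFin; lra.
  have l2 : leb `[0%R, 1%R]%classic = 1%E.
    by rewrite lebesgue_measure_itv /= lte_fin ltr01 -EFinB subr0.
  rewrite /area /B product_measure1E//; transitivity (1 * 1 : \bar R)%E; last by rewrite mule1.
  by congr mule.
have cr : 0 <= c * r ^+ n ^+ 2 by rewrite mulr_ge0 ?sqr_ge0// ltW.
apply: (@le_trans _ _ (\int[@area R]_(p in B) (dens (fun z => z ^+ n) p)%:E)%E); last first.
  apply: ge0_subset_integral => //.
  - exact: hasps_dens_measurable (hasps_monom n).
  - by move=> p _; rewrite lee_fin dens_ge0.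
rewrite -[leLHS]mule1 -aB -integral_cst//.
apply: ge0_le_integral => //.
- apply: measurable_funTS; exact: hasps_dens_measurable (hasps_monom n).
move=> [x y] [/=]; rewrite !in_itv /= => /andP[x1 x2] /andP[y0 y1].
have sqX (v : R) : v ^+ n ^+ 2 = v ^+ 2 ^+ n by rewrite -!exprM mulnC.
rewrite lee_fin /dens cmodX !sqX cmod_sqr /= mulrC; set t := x ^+ 2 + y ^+ 2.
have t1 : r ^+ 2 <= t by rewrite /t; nra.
have t5 : t <= (r + 1) ^+ 2 + 1 by rewrite /t; nra.
apply: ler_pM => //.
- by rewrite exprn_ge0// sqr_ge0.
- exact: ltW.
- by apply: lerXn2r; rewrite ?nnegrE ?sqr_ge0// (le_trans _ t1)// sqr_ge0.
by rewrite ler_expR !mulNr lerN2 ler_pM2l.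
Qed.

Lemma moment_gt0 n : (0 < moment n)%E.
Proof.
have [c c0 h] := moment_ge ler01; apply: lt_le_trans (h n).
by rewrite lte_fin !expr1n mulr1.
Qed.

End Moments.

(** * The Fock norm in terms of Taylor coefficients *)

Section FockNorm.
Local Open Scope complex_scope.
Variable R : realType.
Local Notation C := R[i].
Variable alpha : R.
Hypothesis alpha_gt0 : 0 < alpha.
Implicit Types (f g : C -> C) (a b : nat -> C).

(** The squared Fock norm of z^n, in closed form n! / alpha^n. *)
Definition fweight n : R := alpha / pi * fine (moment alpha n).
Local Notation w := fweight.

Lemma alpha_pi_gt0 : 0 < alpha / pi. Proof. by rewrite divr_gt0 ?pi_gt0. Qed.

Lemma moment_fineK n : ((fine (moment alpha n))%:E = moment alpha n)%E.
Proof. by rewrite fineK// ge0_fin_numE ?moment_lty// moment_ge0. Qed.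

Lemma fweight_gt0 n : 0 < w n.
Proof. by rewrite mulr_gt0 ?alpha_pi_gt0// fine_gt0// moment_gt0// moment_lty. Qed.
Hint Resolve fweight_gt0 : core.

Lemma fweight_ge0 n : 0 <= w n. Proof. exact: ltW. Qed.

Lemma fweight_ge (r : R) : 0 <= r -> exists2 c : R, 0 < c & forall n, c * r ^+ n ^+ 2 <= w n.
Proof.
move=> r0; have [c c0 h] := moment_ge alpha_gt0 r0; exists (alpha / pi * c).
  by rewrite mulr_gt0 ?alpha_pi_gt0.
by move=> n; rewrite -mulrA ler_pM2l ?alpha_pi_gt0// -lee_fin moment_fineK.
Qed.

(** Norm estimates are made on these real partial sums; [fock_intro] and [fock_elim] translate from
    and to the extended real series. *)
Definition psum a n : R := \sum_(0 <= k < n) cmod (a k) ^+ 2 * w k.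

Lemma psum_ge0 a n : 0 <= psum a n.
Proof. by rewrite sumr_ge0// => k _; rewrite mulr_ge0 ?sqr_ge0 ?fweight_ge0. Qed.

Lemma fock_norm2_hasps f a : hasps f a ->
  fock_norm2 alpha f = (\sum_(0 <= n <oo) (cmod (a n) ^+ 2 * w n)%:E)%E.
Proof.
move=> fa; rewrite fock_norm2E (parseval alpha fa) -nneseriesZl//.
  by apply: eq_eseriesr => n _; rewrite -moment_fineK -!EFinM; congr EFin; rewrite /w; ring.
by move=> n _; rewrite mule_ge0 ?moment_ge0// lee_fin sqr_ge0.
Qed.

Lemma fock_intro f a (B : R) : hasps f a -> (forall n, psum a n <= B) ->
  Fock alpha f /\ fock_norm alpha f ^+ 2 <= B.
Proof.
move=> fa aB.
have t0 n : (0 <= (cmod (a n) ^+ 2 * w n)%:E)%E.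
  by rewrite lee_fin mulr_ge0 ?sqr_ge0 ?fweight_ge0.
have le : (fock_norm2 alpha f <= B%:E)%E.
  rewrite (fock_norm2_hasps fa); apply: lime_le; first exact: is_cvg_nneseries.
  by apply: nearW => n; rewrite sumEFin lee_fin; exact: aB.
have ge0 : (0 <= fock_norm2 alpha f)%E by rewrite (fock_norm2_hasps fa); exact: nneseries_ge0.
split; first by split; [exact: hasps_entire fa|rewrite (le_lt_trans le)// ltry].
by rewrite sqr_sqrtr ?fine_ge0// -lee_fin fineK// ge0_fin_numE// (le_lt_trans le)// ltry.
Qed.

Lemma fock_elim f a n : hasps f a -> Fock alpha f -> psum a n <= fock_norm alpha f ^+ 2.
Proof.
move=> fa [_ lty].
have t0 k : (0 <= (cmod (a k) ^+ 2 * w k)%:E)%E.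
  by rewrite lee_fin mulr_ge0 ?sqr_ge0 ?fweight_ge0.
have ge0 : (0 <= fock_norm2 alpha f)%E by rewrite (fock_norm2_hasps fa); exact: nneseries_ge0.
rewrite sqr_sqrtr ?fine_ge0// -lee_fin fineK ?ge0_fin_numE// (fock_norm2_hasps fa).
by rewrite /psum -sumEFin; exact: nneseries_lim_ge.
Qed.

Lemma fock_norm_ge0 f : 0 <= fock_norm alpha f. Proof. exact: sqrtr_ge0. Qed.

(** Domination of coefficients is domination of norms. The norm bound, the truncation error and the
    lower bound for singular values are all instances. *)
Lemma fock_compare f g a b (c : R) : 0 <= c -> hasps f a -> hasps g b ->
  (forall n, cmod (b n) <= c * cmod (a n)) -> Fock alpha f ->
  Fock alpha g /\ fock_norm alpha g <= c * fock_norm alpha f.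
Proof.
move=> c0 fa gb ba Ff.
have H n : psum b n <= (c * fock_norm alpha f) ^+ 2.
  rewrite exprMn; apply: (@le_trans _ _ (c ^+ 2 * psum a n)); last first.
    by rewrite ler_wpM2l ?sqr_ge0// fock_elim.
  rewrite /psum mulr_sumr; apply: ler_sum => k _; rewrite mulrA -exprMn.
  by rewrite ler_wpM2r ?fweight_ge0// lerXn2r ?nnegrE ?mulr_ge0 ?cmod_ge0.
have [Fg le] := fock_intro gb H; split=> //.
by rewrite -(@ler_pXn2r _ 2)// nnegrE ?mulr_ge0 ?fock_norm_ge0.
Qed.

Lemma fock_coef_le f a n : hasps f a -> Fock alpha f ->
  cmod (a n) ^+ 2 * w n <= fock_norm alpha f ^+ 2.
Proof.
move=> fa Ff; apply: le_trans (fock_elim n.+1 fa Ff).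
by rewrite /psum big_nat_recr//= lerDr psum_ge0.
Qed.

(** By Parseval: the zero function has norm 0 by its zero expansion, and this norm bounds the
    coefficients of every other expansion of it. *)
Lemma hasps_inj f a b : hasps f a -> hasps f b -> a = b.
Proof.
move=> fa fb; have := hasps_lin (-1) fa fb.
have -> : (fun z => -1 * f z + f z) = (fun=> 0) by apply/funext => z; ring.
move=> h0; pose o : nat -> C := fun=> 0.
have z0 : hasps (fun=> 0 : C) o.
  move=> z; apply: cvg_near_cst; apply: nearW => n.
  by rewrite subr0 big1 ?cmod0// => k _; rewrite mul0r.
have o0 n : psum o n <= 0.
  by rewrite /psum big1// => k _; rewrite /o cmod0 expr0n mul0r.
have [F0 n0] := fock_intro z0 o0.
apply/funext => n.
have := fock_coef_le n h0 F0; move=> /le_trans/(_ n0).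
rewrite pmulr_lle0// => h.
have : cmod (-1 * a n + b n) == 0 by rewrite -sqrf_eq0 eq_le h sqr_ge0.
rewrite cmod_eq0 mulN1r addrC subr_eq0 => /eqP; exact: esym.
Qed.

Lemma fastdec_of_psum a (B : R) : (forall n, psum a n <= B) -> fastdec a.
Proof.
move=> aB r r0; have [c c0 hc] := fweight_ge r0.
exists (Num.sqrt (B / c)) => n.
rewrite -(@ger0_norm _ (_ * _)) ?mulr_ge0 ?cmod_ge0 ?exprn_ge0// -sqrtr_sqr.
rewrite ler_wsqrtr// ler_pdivlMr// exprMn -mulrA (mulrC _ c).
apply: (@le_trans _ _ (cmod (a n) ^+ 2 * w n)); first by rewrite ler_wpM2l ?sqr_ge0.
apply: le_trans (aB n.+1).
by rewrite /psum big_nat_recr//= lerDr psum_ge0.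
Qed.

Lemma psum_poly_le a N n : psum (fun k => if (k < N)%N then a k else 0) n <= psum a N.
Proof.
have h m : psum (fun k => if (k < N)%N then a k else 0) m <= psum a m.
  apply: ler_sum => k _; case: ifP => // _.
  by rewrite cmod0 expr0n mul0r mulr_ge0 ?sqr_ge0 ?fweight_ge0.
have [nN|Nn] := leqP n N.
  rewrite (le_trans (h n))// /psum (@big_cat_nat _ _ _ n 0 N)//= lerDl.
  by rewrite sumr_ge0// => k _; rewrite mulr_ge0 ?sqr_ge0 ?fweight_ge0.
rewrite /psum (@big_cat_nat _ _ _ N)//= ?(ltnW Nn)// [X in _ + X]big_nat_cond.
rewrite [X in _ + X]big1 ?addr0; first exact: h.
by move=> k; rewrite andbT => /andP[Nk _]; rewrite ltnNge Nk /= cmod0 expr0n mul0r.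
Qed.

Lemma fock_poly a N : Fock alpha (fun z => \sum_(0 <= k < N) a k * z ^+ k).
Proof. by have [] := fock_intro (hasps_poly a N) (psum_poly_le a N). Qed.

Lemma fock_hasps f : Fock alpha f -> hasps f (taylor_coef f).
Proof. by move=> [ef _]; exact: entire_hasps. Qed.

End FockNorm.

(** * Singular values of the Hausdorff operator *)

Section HausdorffMoments.
Local Open Scope complex_scope.
Variable R : realType.
Local Notation C := R[i].
Local Notation Re := (@complex.Re R).
Local Notation Im := (@complex.Im R).
Variable mu : {measure set R -> \bar R}.
Hypothesis mu01 : mu [set` `]0%R, 1%R[] = 0%E.
Hypothesis mu_sup : (ereal_sup (range (fun n : nat =>
  \int[mu]_(t in `[1%R, +oo[) (t ^- n.+1)%:E)) < +oo)%E.

Local Notation E1 := (`[1%R, +oo[%classic : set R).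
Local Notation D0 := (`]0%R, +oo[%classic : set R).

Definition hmoment n : R := fine (\int[mu]_(t in `[1%R, +oo[) (t ^- n.+1)%:E)%E.

Lemma measurable_powV n : measurable_fun D0 (fun t : R => t ^- n.+1).
Proof.
apply: open_continuous_measurable_fun; first exact: interval_open.
move=> t; rewrite inE /= in_itv /= andbT => t0.
by apply: cvgV; [rewrite expf_neq0// gt_eqF|exact: exprn_continuous].
Qed.

Lemma subE1D0 : E1 `<=` D0.
Proof. by move=> t /=; rewrite !in_itv/= !andbT; apply: lt_le_trans. Qed.

Lemma measurable_powV1 n : measurable_fun E1 (fun t : R => t ^- n.+1).
Proof.
by apply: measurable_funS subE1D0 (measurable_powV n); exact: measurable_itv.
Qed.

Lemma powV_ge0 n (t : R) : E1 t -> 0 <= t ^- n.+1.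
Proof.
rewrite /= in_itv/= andbT => t1; rewrite invr_ge0 exprn_ge0//.
exact: le_trans t1.
Qed.

Lemma integral_powV_lty n : (\int[mu]_(t in E1) (t ^- n.+1)%:E < +oo)%E.
Proof. by apply: le_lt_trans mu_sup; apply: ereal_sup_ubound; exists n. Qed.

Lemma integral_powV_ge0 n : (0 <= \int[mu]_(t in E1) (t ^- n.+1)%:E)%E.
Proof. by apply: integral_ge0 => t /powV_ge0; rewrite lee_fin. Qed.

Lemma integrable_powV n : mu.-integrable E1 (EFin \o (fun t => t ^- n.+1)).
Proof.
apply/integrableP; split; first by apply/measurable_EFinP; exact: measurable_powV1.
rewrite (eq_integral (fun t : R => (t ^- n.+1)%:E)); first exact: integral_powV_lty.
by move=> t /set_mem /powV_ge0 t0; rewrite /= ger0_norm.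
Qed.

Lemma hmoment_ge0 n : 0 <= hmoment n.
Proof. by rewrite fine_ge0// integral_powV_ge0. Qed.

Lemma hmoment_nonincr m n : (m <= n)%N -> hmoment n <= hmoment m.
Proof.
move=> mn; rewrite fine_le ?ge0_fin_numE ?integral_powV_lty ?integral_powV_ge0//.
apply: ge0_le_integral => //.
- by move=> t /powV_ge0; rewrite lee_fin.
- by apply/measurable_EFinP; exact: measurable_powV1.
- by apply/measurable_EFinP; exact: measurable_powV1.
move=> t /=; rewrite in_itv/= andbT => t1; rewrite lee_fin.
have t0 : 0 < t by exact: lt_le_trans t1.
by rewrite lef_pV2 ?posrE ?exprn_gt0// ler_weXn2l.
Qed.

Lemma D0_diff : D0 `\` `]0%R, 1%R[%classic = E1.
Proof.
apply/seteqP; split => t /=; rewrite !in_itv/= !andbT.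
  by move=> [t0 /negP]; rewrite t0 /= -leNgt.
move=> t1; split; first exact: lt_le_trans t1.
by apply/negP; rewrite negb_and -!leNgt t1 orbT.
Qed.

(** Termwise integration: on [1, oo) the error is at most B / 2^N times the integrable function 1 /
    t. Convergence on all of (0, oo) makes [u] measurable. *)
Lemma Rintegral_powV_series (u : R -> R) (c : nat -> R) (B : R) :
  (forall t, 0 < t -> \sum_(0 <= k < N) c k * t ^- k.+1 @[N --> \oo] --> u t) ->
  (forall t N, 1 <= t ->
     `|u t - \sum_(0 <= k < N) c k * t ^- k.+1| <= B / 2 ^+ N * t ^- 1) ->
  \sum_(0 <= k < N) c k * hmoment k @[N --> \oo] --> \int[mu]_(t in D0) u t.
Proof.
move=> su eu; have mE : measurable E1 by exact: measurable_itv.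
have mD : measurable D0 by exact: measurable_itv.
pose S N t := \sum_(0 <= k < N) c k * t ^- k.+1.
have mS N : measurable_fun D0 (S N).
  rewrite /S; elim: N => [|N IH]; first by under [X in measurable_fun _ X]eq_fun do rewrite big_geq//; exact: measurable_cst.
  under [X in measurable_fun _ X]eq_fun do rewrite big_nat_recr//=.
  by apply: measurable_funD => //; apply: measurable_funM => //; exact: measurable_powV.
have mu_ : measurable_fun D0 u.
  apply: (measurable_fun_cvg mS) => t; rewrite /= in_itv/= andbT; exact: su.
have iZ (b : R) n : mu.-integrable E1 (EFin \o (fun t => b * t ^- n.+1)).
  exact: (@integrableZl _ _ _ mu E1 mE b _ (integrable_powV n)).
have IZ (b : R) n : \int[mu]_(t in E1) (b * t ^- n.+1) = b * hmoment n.
  by rewrite RintegralZl//; exact: integrable_powV.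
(* The error bound with N = 0 says |u t| <= B / t. *)
have iu : mu.-integrable E1 (EFin \o u).
  apply: le_integrable (iZ B 0%N) => //.
    by apply/measurable_EFinP; exact: measurable_funS subE1D0 mu_.
  move=> t Et; rewrite lee_fin; have := Et; rewrite /= in_itv/= andbT => t1.
  have := eu t 0%N t1; rewrite big_geq// subr0 expr0 divr1 => /le_trans; apply.
  exact: ler_norm.
have iS N : mu.-integrable E1 (EFin \o S N) /\
    \int[mu]_(t in E1) S N t = \sum_(0 <= k < N) c k * hmoment k.
  elim: N => [|N [IH1 IH2]].
    have -> : S 0%N = fun=> 0 by apply/funext => t; rewrite /S big_geq.
    split; first exact: integrable0.
    by rewrite big_geq// Rintegral_cst// mul0r.
  have -> : S N.+1 = fun t => S N t + c N * t ^- N.+1.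
    by apply/funext => t; rewrite /S big_nat_recr.
  split.
    exact: (@integrableD _ _ _ mu E1 mE _ _ IH1 (iZ (c N) N)).
  rewrite RintegralD ?IZ ?IH2 ?big_nat_recr//.
(* The null set ]0, 1[ is dropped, where no bound on [u] is available. *)
have -> : \int[mu]_(t in D0) u t = \int[mu]_(t in E1) u t.
  rewrite /Rintegral -D0_diff -negligible_integral//.
  have mE2 : measurable_fun D0 (EFin \o u) by exact/measurable_EFinP.
  have mN : measurable (`]0%R, 1%R[%classic : set R) by exact: measurable_itv.
  by apply: (negligible_integrable mN mD mE2 mu01).2; rewrite D0_diff.
have e0 : B / 2 ^+ N * hmoment 0 @[N --> \oo] --> (0 : R).
  rewrite -(mul0r (hmoment 0)); apply: cvgM; last exact: cvg_cst.
  rewrite -(mulr0 B); apply: cvgM; first exact: cvg_cst.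
  under eq_fun do rewrite -exprVn; apply: cvg_expr.
  by rewrite ger0_norm// invf_lt1// ltr1n.
apply/cvgrPdist_le => e epos.
move/cvgrPdist_le : e0 => /(_ _ epos); apply: filterS => N; rewrite sub0r normrN => hN.
apply: le_trans hN; have [i1 <-] := iS N; rewrite -RintegralB//.
have iB : mu.-integrable E1 (EFin \o (fun t => u t - S N t)).
  exact: (@integrableB _ _ _ mu E1 mE _ _ iu i1).
rewrite (le_trans (le_normr_Rintegral mE iB))//.
apply: le_trans (ler_norm _); rewrite -IZ; apply: le_Rintegral => //.
  exact: (@integrable_norm _ _ _ mu E1 _ iB).
by move=> t; rewrite /= in_itv/= andbT => t1; exact: eu.
Qed.

(** Termwise, (1/t) (z/t)^k = z^k t^-(k+1). *)
Lemma hausdorff_hasps (f : C -> C) a : hasps f a ->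
  hasps (hausdorff mu f) (fun n => (hmoment n)%:C * a n).
Proof.
move=> fa z; have [M hM] := fastdec_geom (hasps_fastdec fa) (cmod_ge0 z).
pose h t := (t^-1)%:C * f (z / t%:C).
pose b k := a k * z ^+ k.
have term t k : t != 0 -> (t^-1)%:C * (a k * (z / t%:C) ^+ k) = b k * (t ^- k.+1)%:C.
  move=> t0; have tC : t%:C != 0 by rewrite eq_complex /= negb_and t0.
  have e1 : (t^-1)%:C = (t%:C)^-1 by rewrite fmorphV.
  have e2 : (t ^- k.+1)%:C = (t%:C)^-1 * (t%:C)^-1 ^+ k.
    by rewrite -exprVn rmorphXn /= e1 exprS.
  by rewrite e1 e2 /b exprMn; ring.
have sumE t N : t != 0 -> (t^-1)%:C * (\sum_(0 <= k < N) a k * (z / t%:C) ^+ k) =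
    \sum_(0 <= k < N) b k * (t ^- k.+1)%:C.
  by move=> t0; rewrite mulr_sumr; apply: eq_bigr => k _; rewrite term.
have cv t : 0 < t -> ccvg (fun N => \sum_(0 <= k < N) b k * (t ^- k.+1)%:C) (h t).
  move=> t0; have := ccvgZ (t^-1)%:C (fa (z / t%:C)); congr ccvg.
  by apply/funext => N; rewrite sumE// gt_eqF.
(* |z / t| <= |z| for t >= 1, so the geometric bound at |z| serves all [t] at once. *)
have bd t N : 1 <= t -> cmod (h t - \sum_(0 <= k < N) b k * (t ^- k.+1)%:C) <=
    2 * M / 2 ^+ N * t ^- 1.
  move=> t1; have t0 : 0 < t by exact: lt_le_trans t1.
  rewrite -sumE ?gt_eqF// -mulrBr cmodM cmodC ger0_norm ?invr_ge0 ?(ltW t0)//.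
  rewrite expr1 [leLHS]mulrC ler_wpM2r ?invr_ge0 ?(ltW t0)//.
  apply: (@geom_tail _ (fun k => a k * (z / t%:C) ^+ k)); last exact: fa.
  move=> k; apply: le_trans (hM k); rewrite cmodM cmodX cmodM cmodV cmodC.
  rewrite ler_wpM2l ?cmod_ge0// lerXn2r ?nnegrE ?mulr_ge0 ?invr_ge0 ?cmod_ge0//.
  by rewrite (ger0_norm (ltW t0)) ler_pdivrMr// ler_peMr ?cmod_ge0.
have ReE t N : Re (\sum_(0 <= k < N) b k * (t ^- k.+1)%:C) =
    \sum_(0 <= k < N) Re (b k) * t ^- k.+1.
  by rewrite Re_sum; apply: eq_bigr => k _; rewrite cReM /= mulr0 subr0.
have ImE t N : Im (\sum_(0 <= k < N) b k * (t ^- k.+1)%:C) =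
    \sum_(0 <= k < N) Im (b k) * t ^- k.+1.
  by rewrite Im_sum; apply: eq_bigr => k _; rewrite cImM /= mulr0 add0r.
apply/ccvg_ReIm; split.
  have := @Rintegral_powV_series (fun t => Re (h t)) (fun k => Re (b k)) (2 * M).
  move=> /(_ _)/wrap[].
    move=> t t0; have [+ _] := (ccvg_ReIm _ _).1 (cv t t0).
    by under eq_fun do rewrite ReE.
  move=> /(_ _)/wrap[].
    by move=> t N t1; rewrite -ReE -cReN -cReD (le_trans (ler_Re_cmod _))// bd.
  apply: cvg_trans; apply: near_eq_cvg; near=> N.
  rewrite Re_sum; apply: eq_bigr => k _.
  by rewrite -mulrA cReM /= mul0r subr0 mulrC.
have := @Rintegral_powV_series (fun t => Im (h t)) (fun k => Im (b k)) (2 * M).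
move=> /(_ _)/wrap[].
  move=> t t0; have [_ +] := (ccvg_ReIm _ _).1 (cv t t0).
  by under eq_fun do rewrite ImE.
move=> /(_ _)/wrap[].
  by move=> t N t1; rewrite -ImE -cImN -cImD (le_trans (ler_Im_cmod _))// bd.
apply: cvg_trans; apply: near_eq_cvg; near=> N.
rewrite Im_sum; apply: eq_bigr => k _.
by rewrite -mulrA cImM /= mul0r addr0 mulrC.
Unshelve. all: by end_near. Qed.

End HausdorffMoments.

(** * Singular values of a diagonal operator *)

Section DiagonalOperator.
Local Open Scope complex_scope.
Variable R : realType.
Local Notation C := R[i].
Variable alpha : R.
Hypothesis alpha_gt0 : 0 < alpha.
Variables (T : op R) (lam : nat -> R).
Hypothesis lam_ge0 : forall n, 0 <= lam n.
Hypothesis lam_nonincr : forall m n, (m <= n)%N -> lam n <= lam m.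
Hypothesis T_hasps : forall f a, hasps f a -> hasps (T f) (fun n => (lam n)%:C * a n).
Implicit Types (f g : C -> C) (a b : nat -> C) (S K : op R).
Local Notation Fock := (Fock alpha).
Local Notation fock_norm := (fock_norm alpha).

Lemma cmod_lam n (z : C) : cmod ((lam n)%:C * z) = lam n * cmod z.
Proof. by rewrite cmodM cmodC ger0_norm. Qed.

Lemma fock_zero : Fock (fun=> 0).
Proof.
have := fock_poly alpha_gt0 (fun=> 0) 0; congr Defs.Fock.
by apply/funext => z; rewrite big_geq.
Qed.

Lemma op_norm_le S (c : R) : 0 <= c ->
  (forall f, Fock f -> fock_norm (S f) <= c * fock_norm f) ->
  (op_norm alpha S <= c%:E)%E.
Proof.
move=> c0 h; apply: ge_ereal_sup => _ [f [Ff f1] <-].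
by rewrite lee_fin (le_trans (h f Ff))// -[leRHS]mulr1 ler_wpM2l.
Qed.

Lemma op_norm_ge S f : Fock f -> fock_norm f <= 1 ->
  ((fock_norm (S f))%:E <= op_norm alpha S)%E.
Proof. by move=> Ff f1; apply: ereal_sup_ubound; exists f. Qed.

(** The zero function lies in the unit ball, so the supremum is not over the empty set. *)
Lemma op_norm_ge0 S : (0 <= op_norm alpha S)%E.
Proof.
have z0 : hasps (fun=> 0 : C) (fun k => if (k < 0)%N then 0 else 0).
  by have := hasps_poly (fun=> 0 : C) 0; congr hasps; apply/funext => z; rewrite big_geq.
have [F0 n0] := fock_intro alpha_gt0 z0 (psum_poly_le alpha_gt0 (fun=> 0 : C) 0).
apply: le_trans (op_norm_ge S F0 _); first by rewrite lee_fin fock_norm_ge0.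
move: n0; rewrite /psum big_geq// -[X in X <= _]/(_ ^+ 2) => n0.
have : fock_norm (fun=> 0) ^+ 2 == 0 by rewrite eq_le n0 sqr_ge0.
by rewrite sqrf_eq0 => /eqP ->.
Qed.

Lemma diagonal_bound f : Fock f -> Fock (T f) /\ fock_norm (T f) <= lam 0 * fock_norm f.
Proof.
move=> Ff; have fa := fock_hasps Ff.
apply: (fock_compare alpha_gt0 (lam_ge0 0) fa (T_hasps fa)) => // n.
by rewrite cmod_lam ler_wpM2r ?cmod_ge0// lam_nonincr.
Qed.

Lemma diagonal_linear : op_linear alpha T.
Proof.
move=> a f g Ff Fg; have fa := fock_hasps Ff; have ga := fock_hasps Fg.
apply: hasps_unique_fun (T_hasps (hasps_lin a fa ga)) _.
have := hasps_lin a (T_hasps fa) (T_hasps ga); congr hasps.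
by apply/funext => n; ring.
Qed.

Lemma diagonal_bounded : bounded_op alpha T.
Proof.
split; first by move=> f /diagonal_bound[].
split; first exact: diagonal_linear.
apply: (@le_lt_trans _ _ (lam 0)%:E); last exact: ltry.
by apply: op_norm_le => // f /diagonal_bound[].
Qed.

Definition truncation N : op R := fun f z =>
  \sum_(0 <= k < N) ((lam k)%:C * taylor_coef f k) * z ^+ k.

Lemma taylor_coef_lin (c : C) f g n : Fock f -> Fock g ->
  taylor_coef (fun z => c * f z + g z) n = c * taylor_coef f n + taylor_coef g n.
Proof.
move=> Ff Fg; have h := hasps_lin c (fock_hasps Ff) (fock_hasps Fg).
have := hasps_inj alpha_gt0 h (entire_hasps (hasps_entire h)).
by move=> /(congr1 (fun u => u n)).
Qed.

Lemma fock_monom n : Fock (fun z => z ^+ n).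
Proof.
have := fock_poly alpha_gt0 (fun k => (k == n)%:R) n.+1; congr Defs.Fock.
apply/funext => z; rewrite big_nat_recr//= eqxx mul1r big_nat_cond big1 ?add0r// => k.
by rewrite andbT => /andP[_ kn]; rewrite ltn_eqF// mul0r.
Qed.

Lemma truncation_rank N : rank_le alpha N (truncation N).
Proof.
split; first by move=> f _; exact: fock_poly.
split.
  move=> c f g Ff Fg; apply/funext => z; rewrite /truncation mulr_sumr -big_split /=.
  by apply: eq_bigr => k _; rewrite taylor_coef_lin//; ring.
exists (fun i z => z ^+ i); split => [i|f _]; first exact: fock_monom.
exists (fun i => (lam i)%:C * taylor_coef f i); apply/funext => z.
by rewrite /truncation big_mkord.
Qed.

(** The error of [truncation n] has the entries of index at least n, the largest being [lam n]; rank
    at most n corresponds to indices below n, so there is no shift. *)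
Lemma sing_val_le n : (sing_val alpha T n <= (lam n)%:E)%E.
Proof.
apply: (@le_trans _ _ (op_norm alpha (fun f z => T f z - truncation n f z))).
  by apply: ereal_inf_lbound; exists (truncation n) => //; exact: truncation_rank.
apply: op_norm_le => // f Ff; have fa := fock_hasps Ff.
have h := hasps_lin (-1) (hasps_poly (fun k => (lam k)%:C * taylor_coef f k) n) (T_hasps fa).
have h' : hasps (fun z => T f z - truncation n f z)
    (fun k => if (k < n)%N then 0 else (lam k)%:C * taylor_coef f k).
  apply: (hasps_ext _ _ h) => [z|k]; first by rewrite mulN1r addrC.
  by case: ifP => _; ring.
apply: (fock_compare alpha_gt0 (lam_ge0 n) fa h' _ Ff).2 => k.
case: ltnP => [kn|nk]; first by rewrite cmod0 mulr_ge0 ?cmod_ge0.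
by rewrite cmod_lam ler_wpM2r ?cmod_ge0// lam_nonincr.
Qed.

Lemma op_linear0 S : op_linear alpha S -> S (fun=> 0) = (fun=> 0).
Proof.
move=> lS; have := lS (-1) _ _ fock_zero fock_zero.
have -> : (fun z : C => -1 * 0 + 0 : C) = (fun=> 0 : C) by apply/funext => z; rewrite mulr0 addr0.
by move=> ->; apply/funext => z; rewrite mulN1r addNr.
Qed.

Lemma op_linear_poly S a N : op_linear alpha S ->
  S (fun z => \sum_(0 <= k < N) a k * z ^+ k) =
  (fun z => \sum_(0 <= k < N) a k * S (fun z => z ^+ k) z).
Proof.
move=> lS; elim: N => [|N IH].
  have -> : (fun z => \sum_(0 <= k < 0) a k * z ^+ k) = (fun=> 0 : C).
    by apply/funext => z; rewrite big_geq.
  by rewrite op_linear0//; apply/funext => z; rewrite big_geq.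
have -> : (fun z => \sum_(0 <= k < N.+1) a k * z ^+ k) =
   (fun z => a N * z ^+ N + \sum_(0 <= k < N) a k * z ^+ k).
  by apply/funext => z; rewrite big_nat_recr//= addrC.
rewrite lS ?IH; [|exact: fock_monom|exact: fock_poly].
by apply/funext => z; rewrite big_nat_recr//= addrC.
Qed.

(** The n + 1 monomials of degree at most n map into the span of n functions, so their coefficient
    matrix has a left kernel. The scalar [c] allows the polynomial to be normalised later. *)
Lemma rank_le_kernel n K : rank_le alpha n K -> exists a,
  [/\ exists k, a k != 0, forall k, (n < k)%N -> a k = 0 &
   forall c : C, K (fun z => \sum_(0 <= k < n.+1) (c * a k) * z ^+ k) = (fun=> 0)].
Proof.
move=> [mK [lK [g [Fg hg]]]].
have [c hc] := choice (fun k => hg _ (fock_monom k)).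
pose A : 'M[C]_(n.+1, n) := \matrix_(j, i) c j i.
have kA0 : kermx A != 0.
  by rewrite -mxrank_eq0 mxrank_ker -lt0n subn_gt0 ltnS rank_leq_col.
pose v := nz_row (kermx A).
have v0 : v != 0 by rewrite nz_row_eq0.
have vA : v *m A = 0 by apply/sub_kermxP; exact: nz_row_sub.
pose a k := if (k < n.+1)%N then v 0 (inord k) else 0.
exists a; split.
- have [j vj] : exists j, v 0 j != 0.
    apply/existsP; apply: contraNT v0; rewrite negb_exists => /forallP h.
    by apply/eqP/rowP => j; rewrite mxE; apply/eqP; have := h j; rewrite negbK.
  by exists j; rewrite /a ltn_ord inord_val.
- by move=> k nk; rewrite /a ltnNge nk.
move=> d; rewrite op_linear_poly//; apply/funext => z; rewrite big_mkord.
transitivity (\sum_(j < n.+1) \sum_(i < n) d * (v 0 j * A j i) * g i z).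
  apply: eq_bigr => j _; rewrite hc mulr_sumr; apply: eq_bigr => i _.
  by rewrite /a ltn_ord inord_val mxE; ring.
rewrite exchange_big /= big1// => i _; rewrite -mulr_suml -mulr_sumr.
by have /rowP/(_ i) := vA; rewrite !mxE => ->; rewrite mulr0 mul0r.
Qed.

Lemma sing_val_ge n : ((lam n)%:E <= sing_val alpha T n)%E.
Proof.
apply: le_ereal_inf_tmp => _ [K rK <-].
(* The expansion estimate divides by [lam n]. *)
have [->|ln0] := eqVneq (lam n) 0; first exact: op_norm_ge0.
have {}ln0 : 0 < lam n by rewrite lt_def ln0 lam_ge0.
have [a [[k ak] a_out Ka]] := rank_le_kernel rK.
pose p (c : C) z := \sum_(0 <= k < n.+1) (c * a k) * z ^+ k.
have pE (c : C) : hasps (p c) (fun k => c * a k).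
  have := hasps_poly (fun k => c * a k) n.+1; congr hasps; apply/funext => j.
  by case: ltnP => // /a_out ->; rewrite mulr0.
have F1 := fock_poly alpha_gt0 (fun k => 1 * a k) n.+1; rewrite -/(p 1) in F1.
pose s := fock_norm (p 1).
have s0 : 0 < s.
  rewrite lt_neqAle fock_norm_ge0 andbT eq_sym; apply/eqP => s0.
  have := fock_coef_le alpha_gt0 k (pE 1) F1; rewrite -/s s0 expr0n /= mul1r.
  by rewrite pmulr_lle0 ?fweight_gt0// leNgt exprn_gt0// cmod_gt0.
have si0 : 0 <= s^-1 by rewrite invr_ge0 ltW.
have [Ff f1] : Fock (p s^-1%:C) /\ fock_norm (p s^-1%:C) <= s^-1 * fock_norm (p 1).
  apply: (fock_compare alpha_gt0 si0 (pE 1) (pE _)) => // j.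
  by rewrite !cmodM cmod1 mul1r cmodC ger0_norm.
rewrite -/s mulVf ?gt_eqF// in f1.
apply: le_trans (op_norm_ge _ Ff f1).
have -> : (fun z => T (p s^-1%:C) z - K (p s^-1%:C) z) = T (p s^-1%:C).
  by apply/funext => z; rewrite Ka subr0.
have c0 : 0 <= s / lam n by rewrite divr_ge0 ?ltW.
have [FT _] := diagonal_bound Ff.
(* The comparison runs backwards, from T (p / s) to p: s <= (s / lam n) ||T (p / s)||, since lam j
   >= lam n for j <= n. *)
have := (fock_compare alpha_gt0 c0 (T_hasps (pE s^-1%:C)) (pE 1) _ FT).2.
move=> /(_ _)/wrap[|h].
  move=> j; rewrite cmod_lam !cmodM cmod1 mul1r cmodC ger0_norm//.
  have [jn|nj] := leqP j n; last by rewrite a_out// cmod0 !mulr0.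
  have -> : s / lam n * (lam j * (s^-1 * cmod (a j))) = lam j / lam n * cmod (a j).
    by field; rewrite !gt_eqF.
  by rewrite ler_peMl ?cmod_ge0// ler_pdivlMr// mul1r lam_nonincr.
rewrite lee_fin; move: h; rewrite -/s mulrAC ler_pdivlMr// -ler_pdivrMl//.
by rewrite mulKf ?gt_eqF.
Qed.

Lemma sing_valE n : sing_val alpha T n = (lam n)%:E.
Proof. by apply/eqP; rewrite eq_le sing_val_le sing_val_ge. Qed.

End DiagonalOperator.

(** * Extraction of a coordinatewise convergent subsequence *)

Section PointwiseSubsequence.
Local Open Scope complex_scope.
Variable R : realType.
Local Notation C := R[i].
Local Notation Re := (@complex.Re R).
Local Notation Im := (@complex.Im R).

Lemma nbhs_prod_coords (I : eqType) (y : prod_topology (fun _ : I => R))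
    (s : seq I) (e : R) : 0 < e ->
  nbhs y [set z : prod_topology (fun _ : I => R) | forall i, i \in s -> `|z i - y i| < e].
Proof.
move=> e0; elim: s => [|j s IH].
  by apply: (filterS _ (@filterT _ (nbhs y) _)) => z _ i.
have one : nbhs y [set z : prod_topology (fun _ : I => R) | `|z j - y j| < e].
  have h : nbhs (y j) [set r : R | `|r - y j| < e].
    by apply/nbhs_ballP; exists e => //= r; rewrite /ball /= distrC.
  exact: (@proj_continuous I (fun=> R) j y _ h).
apply: (filterS _ (filterI IH one)) => z [h1 h2] i.
by rewrite inE => /predU1P[->//|]; exact: h1.
Qed.

(* Tychonoff gives a cluster point in the product topology; its neighbourhoods
   control finitely many coordinates at a time. *)
Lemma pointwise_subsequence (x : nat -> nat -> C) (B : nat -> R) :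
  (forall k i, cmod (x k i) <= B i) ->
  exists (phi : nat -> nat) (b : nat -> C), (forall k, (phi k < phi k.+1)%N) /\
    forall k i, (i < k)%N -> cmod (x (phi k) i - b i) <= k.+1%:R^-1.
Proof.
move=> xB; pose I : eqType := (nat * bool)%type.
pose X k : forall i : I, R := fun i => if i.2 then Re (x k i.1) else Im (x k i.1).
have := @tychonoff I (fun=> R) (fun i => `[- B i.1, B i.1]%classic)
  (fun i => @segment_compact R _ _).
move=> /(_ (X @ \oo) _) [].
  exists 0%N => // k _ [i c] /=; rewrite in_itv /= -ler_norml.
  by case: c; rewrite /X /=; apply: le_trans (xB k i);
    [exact: ler_Re_cmod|exact: ler_Im_cmod].
move=> y [_ cly].
pose b i : C := y (i, true) +i* y (i, false).
(* Every tail meets every neighbourhood of the cluster point: beyond index q.1, some term is close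
   in the first q.2 coordinates. *)
have pick (q : nat * nat) : exists k, (q.1 <= k)%N /\
    forall i, (i < q.2)%N -> cmod (x k i - b i) <= q.2.+1%:R^-1.
  case: q => m N /=; have e0 : 0 < N.+1%:R^-1 / 2 :> R by rewrite divr_gt0.
  have tail : (X @ \oo) (X @` [set k | (m <= k)%N]).
    by exists m => // k mk; exists k.
  have near_y := nbhs_prod_coords y [seq (i, c) | i <- iota 0 N, c <- [:: true; false]] e0.
  have [z [[k mk <-] hz]] := cly _ _ tail near_y.
  exists k; split=> // i iN.
  have h c : `|X k (i, c) - y (i, c)| < N.+1%:R^-1 / 2.
    by apply: hz; apply: allpairs_f; [rewrite mem_iota|case: c].
  have h1 := h true; have h2 := h false.
  rewrite (le_trans (ler_cmod_ReIm _))// cReD cReN cImD cImN /=.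
  by rewrite (splitr N.+1%:R^-1) lerD// ltW.
have [F hF] := choice pick.
(* Asking for an index beyond the previous one makes [phi] strictly increasing. *)
pose phi := fix phi k := if k is l.+1 then F ((phi l).+1, k) else F (0%N, 0%N).
exists phi, b; split=> [k|]; first by have [] := hF ((phi k).+1, k.+1).
by case=> [//|k] i ik; have [_] := hF ((phi k).+1, k.+1); exact.
Qed.

End PointwiseSubsequence.

(** * Compactness of a diagonal operator with entries tending to 0 *)

Section Compactness.
Local Open Scope complex_scope.
Variable R : realType.
Local Notation C := R[i].
Variable alpha : R.
Hypothesis alpha_gt0 : 0 < alpha.
Variables (T : op R) (lam : nat -> R).
Hypothesis lam_ge0 : forall n, 0 <= lam n.
Hypothesis lam_nonincr : forall m n, (m <= n)%N -> lam n <= lam m.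
Hypothesis T_hasps : forall f a, hasps f a -> hasps (T f) (fun n => (lam n)%:C * a n).
Hypothesis lam_small : forall e : R, 0 < e -> exists n, lam n < e.
Local Notation w := (fweight alpha).
Local Notation psum := (psum alpha).

(** Coefficients converge one by one along a subsequence; [T] turns this into norm convergence, as
    finitely many coordinates converge and small entries damp the others. *)
Lemma diagonal_compact : compact_op alpha T.
Proof.
split; first exact: diagonal_bounded lam_ge0 lam_nonincr T_hasps.
move=> u M hu; pose x k := taylor_coef (u k).
have ux k : hasps (u k) (x k) by have [F _] := hu k; exact: fock_hasps F.
have xM k n : psum (x k) n <= M ^+ 2.
  have [Fu uM] := hu k; apply: le_trans (fock_elim alpha_gt0 n (ux k) Fu) _.
  by rewrite lerXn2r ?nnegrE ?fock_norm_ge0// (le_trans _ uM)// fock_norm_ge0.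
have M2 : 0 <= M ^+ 2 by exact: sqr_ge0.
have w0 n : 0 < w n by exact: fweight_gt0.
have xB k i : cmod (x k i) <= Num.sqrt (M ^+ 2 / w i).
  rewrite -(@ger0_norm _ (cmod _)) ?cmod_ge0// -sqrtr_sqr ler_wsqrtr// ler_pdivlMr//.
  apply: le_trans (xM k i.+1).
  by rewrite /psum big_nat_recr//= lerDr psum_ge0.
have [phi [b [phi_incr xb]]] := pointwise_subsequence xB.
have cvx i : ccvg (fun k => x (phi k) i) (b i).
  have h : k.+1%:R^-1 @[k --> \oo] --> (0 : R) by exact: cvg_harmonic.
  apply: (squeeze_cvgr _ (cvg_cst 0) h); near=> k.
  by rewrite cmod_ge0 xb//; near: k; exact: nbhs_infty_gt.
(* Finite sums pass to the limit, so the limit coefficients define an element [v] of the Fock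
   space. *)
have bM n : psum b n <= M ^+ 2.
  have h : psum (x (phi k)) n @[k --> \oo] --> psum b n.
    rewrite /psum; under eq_fun do rewrite big_mkord; rewrite big_mkord.
    apply: (@cvg_sum_ord _ (fun k i => cmod (x (phi k) i) ^+ 2 * w i)
      (fun i => cmod (b i) ^+ 2 * w i)) => i.
    apply: cvgM; last exact: cvg_cst.
    by rewrite expr2; under eq_fun do rewrite expr2; apply: cvgM; exact: ccvg_cmod.
  rewrite -(cvg_lim (@Rhausdorff R) h); apply: limr_le; first by apply: cvgP h.
  by apply: nearW => k; exact: xM.
have [v ev vb] := fastdec_entire (fastdec_of_psum alpha_gt0 bM).
have [Fv _] := fock_intro alpha_gt0 vb bM.
exists phi, (T v); split=> //; split.
  by have [] := diagonal_bound alpha_gt0 lam_ge0 lam_nonincr T_hasps Fv.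
pose d k i := (lam i)%:C * (x (phi k) i - b i).
have Td k : hasps (fun z => T (u (phi k)) z - T v z) (d k).
  apply: (hasps_ext _ _ (hasps_lin (-1) (T_hasps vb) (T_hasps (ux (phi k))))) => [z|n].
    by rewrite mulN1r addrC.
  by rewrite /d; ring.
(* Head below N and tail from N on; the 4 comes from |p - q|^2 <= 2 |p|^2 + 2 |q|^2, and the tail
   bound does not depend on [k]. *)
have split_sum k N n : psum (d k) n <=
    lam 0 ^+ 2 * psum (fun i => x (phi k) i - b i) N + lam N ^+ 2 * (4 * M ^+ 2).
  have D0 m : 0 <= psum (fun i => x (phi k) i - b i) m by exact: psum_ge0.
  have lam2 i j : (i <= j)%N -> lam j ^+ 2 <= lam i ^+ 2.
    by move=> ij; rewrite lerXn2r ?nnegrE// lam_nonincr.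
  have term i : cmod (d k i) ^+ 2 * w i = lam i ^+ 2 * (cmod (x (phi k) i - b i) ^+ 2 * w i).
    by rewrite /d cmod_lam// exprMn mulrA.
  have t0 i : 0 <= cmod (x (phi k) i - b i) ^+ 2 * w i.
    by rewrite mulr_ge0 ?sqr_ge0// ltW.
  have low m : psum (d k) m <= lam 0 ^+ 2 * psum (fun i => x (phi k) i - b i) m.
    rewrite /psum mulr_sumr; apply: ler_sum => i _; rewrite term.
    by rewrite ler_wpM2r// lam2.
  have [nN|Nn] := leqP n N.
    apply: le_trans (low n) _.
    apply: (@le_trans _ _ (lam 0 ^+ 2 * psum (fun i => x (phi k) i - b i) N)); last first.
      by rewrite lerDl mulr_ge0 ?sqr_ge0// mulr_ge0.
    rewrite ler_wpM2l ?sqr_ge0// /psum (@big_cat_nat _ _ _ n 0 N)//= lerDl.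
    by rewrite sumr_ge0.
  have dM : psum (fun i => x (phi k) i - b i) n <= 4 * M ^+ 2.
    apply: (@le_trans _ _ (2 * psum (x (phi k)) n + 2 * psum b n)); last first.
      by have := xM (phi k) n; have := bM n; lra.
    rewrite /psum !mulr_sumr -big_split /=; apply: ler_sum => i _.
    set p := cmod (x _ i); set q := cmod (b i).
    have -> : 2 * (p ^+ 2 * w i) + 2 * (q ^+ 2 * w i) = (2 * p ^+ 2 + 2 * q ^+ 2) * w i.
      by ring.
    apply: ler_wpM2r; first exact: ltW.
    apply: (@le_trans _ _ ((p + q) ^+ 2)).
      apply: lerXn2r; rewrite ?nnegrE ?addr_ge0 ?cmod_ge0//.
      by rewrite /q -(cmodN (b i)) ler_cmodD.
    rewrite -subr_ge0.
    have -> : 2 * p ^+ 2 + 2 * q ^+ 2 - (p + q) ^+ 2 = (p - q) ^+ 2 by ring.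
    exact: sqr_ge0.
  rewrite /psum (@big_cat_nat _ _ _ N)//= ?(ltnW Nn)//; apply: lerD; first exact: low.
  apply: (@le_trans _ _ (lam N ^+ 2 * psum (fun i => x (phi k) i - b i) n)); last first.
    by rewrite ler_wpM2l ?sqr_ge0.
  apply: (@le_trans _ _ (lam N ^+ 2 *
      \sum_(N <= i < n) (cmod (x (phi k) i - b i) ^+ 2 * w i))).
    rewrite mulr_sumr; apply: ler_sum_nat => i /andP[Ni _]; rewrite term.
    by rewrite ler_wpM2r// lam2.
  rewrite ler_wpM2l ?sqr_ge0// /psum (@big_cat_nat _ _ _ N 0 n)//= ?(ltnW Nn)// lerDr.
  by rewrite sumr_ge0.
have cvD N : psum (fun i => x (phi k) i - b i) N @[k --> \oo] --> (0 : R).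
  have -> : (0 : R) = psum (fun=> 0) N.
    by rewrite /psum big1// => i _; rewrite cmod0 expr0n mul0r.
  rewrite /psum; under eq_fun do rewrite big_mkord; rewrite big_mkord.
  apply: (@cvg_sum_ord _ (fun k i => cmod (x (phi k) i - b i) ^+ 2 * w i)
    (fun i => cmod 0 ^+ 2 * w i)) => i.
  apply: cvgM; last exact: cvg_cst.
  by rewrite cmod0 expr2; under eq_fun do rewrite expr2; apply: cvgM; exact: cvx.
apply/cvgrPdist_le => e e0.
have [N hN] : exists N, lam N ^+ 2 * (4 * M ^+ 2) <= e ^+ 2 / 2.
  (* Squaring lam N * 4 (m + 1) < e, with m = M^2, suffices because 8 m <= 16 (m + 1)^2. *)
  have k0 : 0 < e / (4 * (M ^+ 2 + 1)) by rewrite divr_gt0// mulr_gt0// ltr_wpDl.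
  have [N hN] := lam_small k0; exists N.
  set m := M ^+ 2 in k0 hN M2 *.
  have h1 : lam N * (4 * (m + 1)) < e by rewrite -ltr_pdivlMr// mulr_gt0// ltr_wpDl.
  have h2 : (lam N * (4 * (m + 1))) ^+ 2 <= e ^+ 2.
    by rewrite lerXn2r ?nnegrE ?mulr_ge0 ?addr_ge0// ltW.
  have h3 : 0 <= lam N ^+ 2 by rewrite sqr_ge0.
  have h4 : (lam N * (4 * (m + 1))) ^+ 2 = lam N ^+ 2 * (16 * (m + 1) ^+ 2) by ring.
  have h5 : lam N ^+ 2 * (4 * m * 2) <= lam N ^+ 2 * (16 * (m + 1) ^+ 2).
    by rewrite ler_wpM2l//; nra.
  by move: h2; rewrite h4; lra.
have e20 : 0 < e ^+ 2 / 2 by rewrite divr_gt0// exprn_gt0.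
(* The 1 keeps the divisor positive when [lam 0] vanishes. *)
have e2l : 0 < e ^+ 2 / 2 / (lam 0 ^+ 2 + 1) by rewrite divr_gt0// ltr_wpDl ?sqr_ge0.
move/cvgrPdist_le : (cvD N) => /(_ _ e2l); apply: filterS => k.
rewrite !sub0r !normrN !ger0_norm ?fock_norm_ge0 ?psum_ge0// => hk.
have [_ le] := fock_intro alpha_gt0 (Td k) (split_sum k N).
rewrite -(@ler_pXn2r _ 2)// ?nnegrE ?fock_norm_ge0 ?(ltW e0)//.
apply: le_trans le _; rewrite (splitr (e ^+ 2)) lerD//.
have l2 : 0 <= lam 0 ^+ 2 by rewrite sqr_ge0.
apply: (@le_trans _ _ (lam 0 ^+ 2 * (e ^+ 2 / 2 / (lam 0 ^+ 2 + 1)))).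
  by rewrite ler_wpM2l.
rewrite mulrCA ger_pMr// ler_pdivrMr ?mul1r ?lerDl// ltr_wpDl//.
Unshelve. all: by end_near. Qed.

End Compactness.

(** * From summability to Schatten class membership *)

Lemma nonincr_powR_summable_small (R : realType) (lam : nat -> R) (p : R) :
  (forall n, 0 <= lam n) -> (forall m n, (m <= n)%N -> lam n <= lam m) -> 0 < p ->
  (\sum_(0 <= n <oo) (lam n `^ p)%:E < +oo)%E ->
  forall e, 0 < e -> exists n, lam n < e.
Proof.
move=> lam0 ni p0 fin e e0; apply: contrapT => /forallNP h.
have le n : e `^ p <= lam n `^ p.
  by apply: ge0_ler_powR; rewrite ?nnegrE ?(ltW e0) ?(ltW p0)// leNgt; apply/negP/h.
have ep : 0 < e `^ p by exact: powR_gt0.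
have t0 n : (0 <= (lam n `^ p)%:E)%E by rewrite lee_fin powR_ge0.
move: fin; rewrite -ge0_fin_numE; last exact: nneseries_ge0.
move=> /fineK; set S := fine _ => SE.
have S0 : 0 <= S by rewrite fine_ge0// nneseries_ge0.
(* If no entry were below [e], the partial sums would grow linearly, against the Archimedean
   property. *)
have part n : n%:R * e `^ p <= S.
  rewrite -lee_fin SE; apply: le_trans (nneseries_lim_ge n (fun k _ _ => t0 k)).
  rewrite sumEFin lee_fin big_mkord mulr_natl -{1}(card_ord n) -sumr_const.
  exact: ler_sum.
have := archi_boundP (divr_ge0 S0 (ltW ep)).
by rewrite ltr_pdivrMr// ltNge part.
Qed.

Unset Implicit Arguments.

(** A Borel measure on (0, oo) is encoded as a measure on the line that vanishes on ]-oo, 0]. *)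
Theorem theorem4 (R : realType) (alpha : R) (mu : {measure set R -> \bar R})
  (p : R) :
  0 < alpha ->
  mu [set` `]-oo, 0]] = 0%E ->
  mu [set` `]0, 1[] = 0%E ->
  (ereal_sup (range (fun n : nat =>
     \int[mu]_(t in `[1%R, +oo[) (t ^- n.+1)%:E)) < +oo)%E ->
  0 < p ->
  (schatten alpha p (hausdorff mu) <->
   (\sum_(0 <= n <oo)
      ((fine (\int[mu]_(t in `[1%R, +oo[) (t ^- n.+1)%:E)) `^ p)%:E < +oo)%E).
Proof.
move=> a0 _ mu01 mu_sup p0.
have l0 := hmoment_ge0 mu.
have ni := hmoment_nonincr mu_sup.
have Th := hausdorff_hasps mu01 mu_sup.
have E : (\sum_(0 <= n <oo) ((fine (sing_val alpha (hausdorff mu) n)) `^ p)%:E)%E =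
    (\sum_(0 <= n <oo) (hmoment mu n `^ p)%:E)%E.
  by apply: eq_eseriesr => n _; rewrite (sing_valE a0 l0 ni Th).
(* The two series coincide; what remains for the converse is compactness, which summability yields
   through small entries. *)
rewrite /schatten E; split=> [[_ h]|fin]; first exact: h.
split; last exact: fin.
apply: (diagonal_compact a0 l0 ni Th).
exact: (nonincr_powR_summable_small l0 ni p0 fin).
Qed.
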